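(* Let $\mathcal X\subseteq\mathbb R^d$ be contained in the closure of its interior, let $K\in\mathcal C^{s,s}(\mathcal X\times\mathcal X,\mathbb R^{Q\times Q})$ ($s\in\mathbb N$) be a matrix-valued kernel with vector-valued RKHS $\mathcal F_K$, and let $[I]$ ($I\in\mathbb N$) be partitioned into disjoint sets $\mathcal I_{\mathrm{SOC}}$ and $\mathcal I_\Omega$. Let $C^i_{P_i,\mathrm{SOC}}$ ($i\in\mathcal I_{\mathrm{SOC}}$) and $C^i_{1,\Omega}$ ($i\in\mathcal I_\Omega$) be the tightened constraint sets defined in the context and $C_{\mathrm{app}}:=\big(\bigcap_{i\in\mathcal I_{\mathrm{SOC}}}C^i_{P_i,\mathrm{SOC}}\big)\cap\big(\bigcap_{i\in\mathcal I_\Omega}C^i_{1,\Omega}\big)$. For fixed samples $(\mathbf x_n)_{n\in[N]}\subset\mathcal X$ let $$\mathcal L_S(\mathbf f,\mathbf b)=L\Big(\mathbf b,\big(\big(D^0_{n,j}(\mathbf f)(\mathbf x_n)\big)_{j\in J_n}\big)_{n\in[N]}\Big)+R(\|\mathbf f\|_K),\qquad(\mathbf f,\mathbf b)\in\mathcal F_K\times\mathbb R^B,$$ with finite index sets $J_n$, linear differential operators $(D^0_{n,j})_{j\in J_n}\subset O_{Q,s}$, a loss $L:\mathbb R^B\times\mathbb R^{\sum_{n\in[N]}\#J_n}\to\mathbb R\cup\{\infty\}$ and a non-decreasing regularizer $R:[0,\infty)\to\mathbb R$. Consider the problem $$(\mathscr P_{\mathrm{app}}):\quad\min_{\mathbf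 f\in\mathcal F_K,\ \mathbf b\in\mathbb R^B,\ (\mathbf f,\mathbf b)\in C_{\mathrm{app}}}\mathcal L_S(\mathbf f,\mathbf b).$$ (Representer theorem) Assume that there exists a minimizer of $(\mathscr P_{\mathrm{app}})$. Then there also exists a minimizer $(\bar{\mathbf f}_{\mathrm{app}},\bar{\mathbf b}_{\mathrm{app}})$ such that $$\bar{\mathbf f}_{\mathrm{app}}=\sum_{n\in[N]}\sum_{j\in J_n}a_{L,n,j}D^0_{n,j}K(\cdot,\mathbf x_n)+\sum_{i\in\mathcal I_{\mathrm{SOC}}}\sum_{p_1,p_2\in[P_i]}\sum_{m\in[M_i]}a_{S,i,p_1,p_2,m}D^i_{p_1,p_2}K(\cdot,\tilde{\mathbf x}_{i,m})$$ $$\qquad+\sum_{i\in\mathcal I_\Omega}\sum_{m\in[M_i]}\Big[\sum_{j\in[J_{B,i,m}]}a_{B,i,m,j}\mathbf c_{i,m,j}+\sum_{j\in[J_{H,i,m}]}a_{H,i,m,j}\mathbf v_{i,m,j}\Big]+\sum_{i\in[I]}a_{0,i}\mathbf f_{0,i}$$ with some real coefficients $a_{L,n,j}$, $a_{S,i,p_1,p_2,m}$, $a_{B,i,m,j}$, $a_{H,i,m,j}$, $a_{0,i}$. (Existence) Furthermore, $\mathcal L_S+\chi_{C_{\mathrm{app}}}$ is weakly lower semi-continuous and coercive on $\mathcal F_K\times\mathbb R^B$ provided that: (i) $\lim_{z\to\infty}R(z)=\infty$; (ii) $L$ is ''uniformly'' coercive in $\mathbf b$, i.e. $\lim_{\|\mathbf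 b\|_2\to\infty}\inf_{\|\mathbf y\|_2\le r}L(\mathbf b,\mathbf y)=\infty$ for any $r>0$; (iii) $L$ is lower bounded over $C_{\mathrm{app}}$, i.e. $(\mathbf f,\mathbf b)\mapsto L\big(\mathbf b,((D^0_{n,j}(\mathbf f)(\mathbf x_n))_{j\in J_n})_{n\in[N]}\big)$ is bounded from below on $C_{\mathrm{app}}$; (iv) the functions $L$ and $R$ are lower semi-continuous.
   Context: $[n]=\{1,\dots,n\}$; $\preccurlyeq$ is the Loewner order; $\mathbf I_P$ the identity; $\mathscr S^{P-1}$ the Euclidean unit sphere of $\mathbb R^P$; $\|\cdot\|_{\mathcal X}$ a fixed norm on $\mathbb R^d$; $\mathbb B_{\mathcal X}(\mathbf c,r)=\{\mathbf x\in\mathcal X:\|\mathbf x-\mathbf c\|_{\mathcal X}\le r\}$. $\chi_A$ is $0$ on $A$ and $+\infty$ outside. A function to $\mathbb R\cup\{\infty\}$ on a Hilbert space is weakly l.s.c. if its sublevel sets $\{g\le\gamma\}$, $\gamma\in\mathbb R$, are weakly closed, and coercive if they are all bounded. Kernels and operators. Matrix-valued kernel: $K(\mathbf x,\mathbf x')=K(\mathbf x',\mathbf x)^\top$ and $\sum_{i,j}\mathbf v_i^\top K(\mathbf x_i,\mathbf x_j)\mathbf v_j\ge0$ for all finite families. $\mathcal F_K$ (inner product $\langle\cdot,\cdot\rangle_K$, norm $\|\cdot\|_K$) is the Hilbert space of functions $\mathcal X\to\mathbb R^Q$ containing all $K(\cdot,\mathbf x)\mathbf c$ with $\langle\mathbf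 f,K(\cdot,\mathbf x)\mathbf c\rangle_K=\langle\mathbf f(\mathbf x),\mathbf c\rangle$. $\mathcal C^{s,s}$: $\partial^{\mathbf r,\mathbf r}$ (order $\mathbf r$ in each of the two arguments) exists and is continuous for all $|\mathbf r|\le s$ (derivatives at non-interior points are continuous extensions from the interior). $O_{1,s}$: operators $f\mapsto\sum_{j\in J}c_j\partial^{\mathbf r_j}f$, $J$ finite, $|\mathbf r_j|\le s$, $c_j\in\mathbb R$. $O_{Q,s}$: operators $D(\mathbf f)(\mathbf x)=\sum_{q\in[Q]}\beta_qD_q(f_q)(\mathbf x)$, $\beta_q\in\mathbb R$, $D_q\in O_{1,s}$. For such $D$, $DK(\mathbf x',\mathbf x):=\sum_q\beta_qD_q[\mathbf x''\mapsto K(\mathbf x',\mathbf x'')](\mathbf x)\mathbf e_q\in\mathbb R^Q$; every $\mathbf f\in\mathcal F_K$ is $\mathcal C^s$, $DK(\cdot,\mathbf x)\in\mathcal F_K$ and $D(\mathbf f)(\mathbf x)=\langle\mathbf f,DK(\cdot,\mathbf x)\rangle_K$. Data. For $i\in[I]$ we are given a compact set $\mathscr K_i\subseteq\mathcal X$, an integer $P_i\ge1$ with $P_i=1$ if $i\in\mathcal I_\Omega$, $\mathbf D_i=[D^i_{p_1,p_2}]_{p_1,p_2\in[P_i]}$ with $D^i_{p_1,p_2}\in O_{Q,s}$ and $\mathbf D_i(\mathbf f)(\mathbf x)$ always symmetric (for $P_i=1$ write $D_i$), $\mathbf f_{0,i}\in\mathcal F_K$, $\mathbf b_{0,i}\in\mathbb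 R^{P_i}$, $\boldsymbol\Gamma_i\in\mathbb R^{P_i\times B}$. Tightened constraints, $i\in\mathcal I_{\mathrm{SOC}}$. Fix finitely many $\tilde{\mathbf x}_{i,m}\in\mathcal X$, $\delta_{i,m}>0$ ($m\in[M_i]$) with $\mathscr K_i\subseteq\bigcup_m\mathbb B_{\mathcal X}(\tilde{\mathbf x}_{i,m},\delta_{i,m})$, let $$\eta_{i,m,P_i}=\sup_{\mathbf x\in\mathbb B_{\mathcal X}(\tilde{\mathbf x}_{i,m},\delta_{i,m}),\ \mathbf u\in\mathscr S^{P_i-1}}\Big\|\sum_{p_1,p_2\in[P_i]}u_{p_1}u_{p_2}[D^i_{p_1,p_2}K(\cdot,\tilde{\mathbf x}_{i,m})-D^i_{p_1,p_2}K(\cdot,\mathbf x)]\Big\|_K$$ and let $C^i_{P_i,\mathrm{SOC}}$ be the set of $(\mathbf f,\mathbf b)\in\mathcal F_K\times\mathbb R^B$ with $\eta_{i,m,P_i}\|\mathbf f-\mathbf f_{0,i}\|_K\mathbf I_{P_i}\preccurlyeq\mathbf D_i(\mathbf f-\mathbf f_{0,i})(\tilde{\mathbf x}_{i,m})+\operatorname{diag}(\boldsymbol\Gamma_i\mathbf b-\mathbf b_{0,i})$ for all $m\in[M_i]$. Tightened constraints, $i\in\mathcal I_\Omega$. Fix finitely many non-empty sets $$\Omega_{i,m}=\Big(\bigcap_{j\in[J_{B,i,m}]}\{\mathbf g\in\mathcal F_K:\|\mathbf g-\mathbf c_{i,m,j}\|_K<r_{i,m,j}\}\Big)\cap\Big(\bigcap_{j\in[J_{H,i,m}]}\{\mathbf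 g\in\mathcal F_K:\langle\mathbf v_{i,m,j},\mathbf g\rangle_K<\rho_{i,m,j}\}\Big),\quad m\in[M_i],$$ with $\mathbf c_{i,m,j}\in\mathcal F_K$, $r_{i,m,j}>0$, $\mathbf 0\ne\mathbf v_{i,m,j}\in\mathcal F_K$, $\rho_{i,m,j}\in\mathbb R$, such that $\{D_iK(\cdot,\mathbf x):\mathbf x\in\mathscr K_i\}\subseteq\bigcup_{m}\overline{\Omega_{i,m}}$. $C^i_{1,\Omega}$ is the set of $(\mathbf f,\mathbf b)\in\mathcal F_K\times\mathbb R^B$ such that for every $m\in[M_i]$ there exist $\mathbf g_j\in\operatorname{span}(\mathbf f-\mathbf f_{0,i},\{\mathbf c_{i,m,l}\}_l,\{\mathbf v_{i,m,l}\}_l)$ ($j\in[J_{B,i,m}]$) and $\xi_j\ge0$ ($j\in[J_{H,i,m}]$) with $$-b_{0,i}+\boldsymbol\Gamma_i\mathbf b+\sum_j\langle\mathbf g_j,\mathbf c_{i,m,j}\rangle_K-\sum_j\xi_j\rho_{i,m,j}-\sum_jr_{i,m,j}\|\mathbf g_j\|_K\ge0,\qquad-(\mathbf f-\mathbf f_{0,i})+\sum_j\mathbf g_j-\sum_j\xi_j\mathbf v_{i,m,j}=\mathbf 0$$ (equivalently, $\Omega_{i,m}\subseteq\{\mathbf g:\langle\mathbf f-\mathbf f_{0,i},\mathbf g\rangle_K\ge b_{0,i}-\boldsymbol\Gamma_i\mathbf b\}$ for all $m$). *)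

(* Defs.v *)
From HB Require Import structures.
From mathcomp Require Import all_boot all_order all_algebra.
From mathcomp Require Import all_classical all_reals all_analysis.
Set Implicit Arguments.
Unset Strict Implicit.
Unset Printing Implicit Defensive.
Import Order.TTheory GRing.Theory Num.Theory.
Import numFieldNormedType.Exports.
Local Open Scope classical_set_scope.
Local Open Scope ring_scope.

(* A function X -> R^Q on a set X of points of R^d is encoded by its extension
   by zero to R^d: the members of the RKHS below are total functions vanishing
   outside X. Kernels are total functions whose values outside X * X are
   never used. *)
Notation vfun R d Q := ('rV[R]_d -> 'cV[R]_Q).
Notation mvkern R d Q := ('rV[R]_d -> 'rV[R]_d -> 'M[R]_Q).

Definition dotv (R : realType) n (u v : 'cV[R]_n) : R := \sum_i u i 0 * v i 0.

(* The library norm of matrices is the sup norm. *)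
Definition l2norm (R : realType) m n (A : 'M[R]_(m, n)) : R :=
  Num.sqrt (\sum_i \sum_j A i j ^+ 2).

Definition unit_sphere (R : realType) n : set 'cV[R]_n :=
  [set u | l2norm u = 1].

Definition is_norm (R : realType) (V : lmodType R) (nu : V -> R) : Prop :=
  [/\ forall x, 0 <= nu x,
      forall x, nu x = 0 -> x = 0,
      forall a x, nu (a *: x) = `|a| * nu x
    & forall x y, nu (x + y) <= nu x + nu y].

(* The closed ball of X (not of R^d) for the norm nu. *)
Definition ballX (R : realType) d (X : set 'rV[R]_d) (nu : 'rV[R]_d -> R)
    (c : 'rV[R]_d) (r : R) : set 'rV[R]_d :=
  [set x | X x /\ nu (x - c) <= r].

Definition loewner_le (R : realType) n (A B : 'M[R]_n) : Prop :=
  (B - A)^T = B - A /\ forall u : 'cV[R]_n, 0 <= dotv u ((B - A) *m u).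

(* Hilbert spaces are given by a carrier H inside an ambient vector space and a
   form on the ambient space, of which only the values on H matter. *)

Definition ip_norm (R : realType) (V : lmodType R) (ip : V -> V -> R) (x : V)
  : R := Num.sqrt (ip x x).

Record is_hilbert (R : realType) (V : lmodType R) (H : set V)
    (ip : V -> V -> R) : Prop := IsHilbert {
  hilbert0 : H 0;
  hilbert_lin : forall a x y, H x -> H y -> H (a *: x + y);
  hilbert_sym : forall x y, H x -> H y -> ip x y = ip y x;
  hilbert_linl : forall a x y z, H x -> H y -> H z ->
    ip (a *: x + y) z = a * ip x z + ip y z;
  hilbert_pos : forall x, H x -> x != 0 -> 0 < ip x x;
  hilbert_complete : forall u : nat -> V, (forall n, H (u n)) ->
    (forall e, 0 < e -> exists N, forall m n, (N <= m)%N -> (N <= n)%N ->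
       ip_norm ip (u m - u n) < e) ->
    exists2 l, H l & ip_norm ip (u n - l) @[n --> \oo] --> (0 : R) }.

Definition ip_closure (R : realType) (V : lmodType R) (H : set V)
    (ip : V -> V -> R) (A : set V) : set V :=
  [set x | H x /\ forall e, 0 < e -> exists2 y, A y & ip_norm ip (x - y) < e].

Definition is_dual (R : realType) (V : lmodType R) (H : set V)
    (ip : V -> V -> R) (phi : V -> R) : Prop :=
  (forall a x y, H x -> H y -> phi (a *: x + y) = a * phi x + phi y) /\
  (exists C : R, forall x, H x -> `|phi x| <= C * ip_norm ip x).

(* A subset A of H is weakly closed iff every point of H outside A has a basic
   weak neighbourhood, cut out by finitely many continuous linear functionals,
   that misses A. *)
Definition weakly_closed (R : realType) (V : lmodType R) (H : set V)
    (ip : V -> V -> R) (A : set V) : Prop :=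
  A `<=` H /\
  forall x, H x -> ~ A x ->
    exists (n : nat) (phi : 'I_n -> V -> R) (e : R),
      [/\ 0 < e, forall k, is_dual H ip (phi k)
        & forall y, H y -> (forall k, `|phi k y - phi k x| < e) -> ~ A y].

Definition weakly_lsc (R : realType) (V : lmodType R) (H : set V)
    (ip : V -> V -> R) (g : V -> \bar R) : Prop :=
  forall gam : R, weakly_closed H ip [set x | H x /\ (g x <= gam%:E)%E].

Definition coercive (R : realType) (V : lmodType R) (H : set V)
    (ip : V -> V -> R) (g : V -> \bar R) : Prop :=
  forall gam : R, exists rho : R,
    forall x, H x -> (g x <= gam%:E)%E -> ip_norm ip x <= rho.

Definition ip_prod (R : realType) (V : lmodType R) n (ip : V -> V -> R)
    (x y : V * 'cV[R]_n) : R := ip x.1 y.1 + dotv x.2 y.2.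

Definition char_fun (R : realType) T (A : set T) (x : T) : \bar R :=
  if x \in A then 0%E else +oo%E.

Definition minimizer (R : realType) T (C : set T) (J : T -> \bar R) (x : T)
  : Prop := C x /\ forall y, C y -> (J x <= J y)%E.

Definition msize d (r : 'I_d -> nat) : nat := \sum_i r i.

(* d^r applies the partial derivatives of the last coordinate first. *)
Definition mword d (r : 'I_d -> nat) : seq 'I_d :=
  flatten [seq nseq (r i) i | i <- enum 'I_d].

Fixpoint iter_partial (R : realType) d (w : seq 'I_d) (f : 'rV[R]_d -> R)
  : 'rV[R]_d -> R :=
  if w is i :: w' then 'D_(delta_mx 0 i) (iter_partial w' f) else f.

Fixpoint iter_derivable (R : realType) d (U : set 'rV[R]_d) (w : seq 'I_d)
    (f : 'rV[R]_d -> R) : Prop :=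
  if w is i :: w' then
    iter_derivable U w' f /\
    forall x, U x -> derivable (iter_partial w' f) x (delta_mx 0 i)
  else True.

Definition partial (R : realType) d (r : 'I_d -> nat) (f : 'rV[R]_d -> R)
  : 'rV[R]_d -> R := iter_partial (mword r) f.

(* At the points of X that are not interior, the derivative is the continuous
   extension of the derivative on the interior. *)
Definition partialX (R : realType) d (X : set 'rV[R]_d) (r : 'I_d -> nat)
    (f : 'rV[R]_d -> R) (x : 'rV[R]_d) : R :=
  if x \in (X° : set _) then partial r f x
  else lim (partial r f y @[y --> within X° (nbhs x)]).

Definition partial2 (R : realType) d (r : 'I_d -> nat)
    (k : 'rV[R]_d -> 'rV[R]_d -> R) (x y : 'rV[R]_d) : R :=
  partial r (fun x' => partial r (k x') y) x.

(* k is C^{s,s} on X * X: k is continuous there, and for |r| <= s the derivative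
   of order r in each argument exists on the interior and extends continuously
   to X * X. *)
Definition smooth2 (R : realType) d (X : set 'rV[R]_d) (s : nat)
    (k : 'rV[R]_d -> 'rV[R]_d -> R) : Prop :=
  {within X `*` X, continuous (fun z => k z.1 z.2)} /\
  forall r : 'I_d -> nat, (msize r <= s)%N ->
    [/\ forall x, X° x -> iter_derivable X° (mword r) (k x),
        forall y, X° y ->
          iter_derivable X° (mword r) (fun x => partial r (k x) y)
      & exists G : 'rV[R]_d * 'rV[R]_d -> R,
          {within X `*` X, continuous G} /\
          forall x y, X° x -> X° y -> G (x, y) = partial2 r k x y].

Definition smooth_kernel (R : realType) d Q (X : set 'rV[R]_d) (s : nat)
    (K : mvkern R d Q) : Prop :=
  forall p q, smooth2 X s (fun x y => K x y p q).

Definition is_mvkernel (R : realType) d Q (X : set 'rV[R]_d)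
    (K : mvkern R d Q) : Prop :=
  (forall x y, X x -> X y -> K x y = (K y x)^T) /\
  (forall n (x : 'I_n -> 'rV[R]_d) (v : 'I_n -> 'cV[R]_Q),
     (forall i, X (x i)) ->
     0 <= \sum_i \sum_j dotv (v i) (K (x i) (x j) *m v j)).

(* K(., x) c *)
Definition ksection (R : realType) d Q (X : set 'rV[R]_d) (K : mvkern R d Q)
    (x : 'rV[R]_d) (c : 'cV[R]_Q) : vfun R d Q :=
  patch (fun=> 0) X (fun x' => K x' x *m c).

Record is_rkhs (R : realType) d Q (X : set 'rV[R]_d) (K : mvkern R d Q)
    (F : set (vfun R d Q)) (ip : vfun R d Q -> vfun R d Q -> R) : Prop :=
  IsRkhs {
    rkhs_hilbert : is_hilbert F ip;
    rkhs_supp : forall f, F f -> forall x, ~ X x -> f x = 0;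
    rkhs_section : forall x c, X x -> F (ksection X K x c);
    rkhs_reproducing : forall f x c, F f -> X x ->
      ip f (ksection X K x c) = dotv (f x) c }.

(* The operator f |-> sum_j c_j d^{r_j} f with |r_j| <= s is represented by the
   list of its terms (c_j, r_j). *)
Record diffop1 (R : realType) (d s : nat) := Diffop1 {
  diffop1_terms : seq (R * ('I_d -> nat));
  diffop1_order : all (fun t => (msize t.2 <= s)%N) diffop1_terms }.

(* The operator f |-> sum_q beta_q D_q(f_q) on R^Q-valued functions is
   represented by the family of the (beta_q, D_q). *)
Definition diffop (R : realType) (d Q s : nat) := 'I_Q -> R * diffop1 R d s.

Definition op1_at (R : realType) d s (X : set 'rV[R]_d) (D : diffop1 R d s)
    (f : 'rV[R]_d -> R) (x : 'rV[R]_d) : R :=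
  \sum_(t <- diffop1_terms D) t.1 * partialX X t.2 f x.

Definition op_at (R : realType) d Q s (X : set 'rV[R]_d) (D : diffop R d Q s)
    (f : vfun R d Q) (x : 'rV[R]_d) : R :=
  \sum_q (D q).1 * op1_at X (D q).2 (fun y => f y q 0) x.

(* The function x' |-> sum_q beta_q D_q[x'' |-> K(x', x'')](x) e_q, with D_q
   acting entrywise on the matrix K(x', x''). *)
Definition opK (R : realType) d Q s (X : set 'rV[R]_d) (D : diffop R d Q s)
    (K : mvkern R d Q) (x : 'rV[R]_d) : vfun R d Q :=
  patch (fun=> 0) X (fun x' => \sum_q (D q).1 *:
    ((\matrix_(p1, p2) op1_at X (D q).2 (fun x'' => K x' x'' p1 p2) x)
       *m delta_mx q 0)).

Definition opmx (R : realType) d Q s P (X : set 'rV[R]_d)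
    (D : 'I_P -> 'I_P -> diffop R d Q s) (f : vfun R d Q) (x : 'rV[R]_d)
  : 'M[R]_P := \matrix_(p1, p2) op_at X (D p1 p2) f x.

(* The supremum is taken in the extended reals, since it may be infinite when X
   is not closed. *)
Definition eta_soc (R : realType) d Q s P (X : set 'rV[R]_d)
    (nu : 'rV[R]_d -> R) (K : mvkern R d Q)
    (ip : vfun R d Q -> vfun R d Q -> R) (D : 'I_P -> 'I_P -> diffop R d Q s)
    (xt : 'rV[R]_d) (del : R) : \bar R :=
  ereal_sup [set (ip_norm ip (\sum_p1 \sum_p2 (xu.2 p1 0 * xu.2 p2 0) *:
      (opK X (D p1 p2) K xt - opK X (D p1 p2) K xu.1)))%:E
    | xu in ballX X nu xt del `*` @unit_sphere R P].

(* The product eta * ||f - f0|| uses the convention +oo * 0 = 0; when it is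
   infinite the constraint fails. *)
Definition C_soc (R : realType) d Q s P B M (X : set 'rV[R]_d)
    (nu : 'rV[R]_d -> R) (K : mvkern R d Q) (F : set (vfun R d Q))
    (ip : vfun R d Q -> vfun R d Q -> R) (D : 'I_P -> 'I_P -> diffop R d Q s)
    (f0 : vfun R d Q) (b0 : 'cV[R]_P) (Gam : 'M[R]_(P, B))
    (xt : 'I_M -> 'rV[R]_d) (del : 'I_M -> R)
  : set (vfun R d Q * 'cV[R]_B) :=
  [set fb | F fb.1 /\ forall m : 'I_M, exists2 e : R,
     (eta_soc X nu K ip D (xt m) (del m) * (ip_norm ip (fb.1 - f0))%:E
        = e%:E)%E &
     loewner_le e%:M
       (opmx X D (fb.1 - f0) (xt m) + diag_mx (Gam *m fb.2 - b0)^T)].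

Definition Omega_set (R : realType) d Q JB JH (F : set (vfun R d Q))
    (ip : vfun R d Q -> vfun R d Q -> R)
    (c : 'I_JB -> vfun R d Q) (r : 'I_JB -> R)
    (v : 'I_JH -> vfun R d Q) (rho : 'I_JH -> R) : set (vfun R d Q) :=
  [set g | [/\ F g, forall j, ip_norm ip (g - c j) < r j
             & forall j, ip (v j) g < rho j]].

Definition span_of (R : realType) (V : lmodType R) JB JH (h : V)
    (c : 'I_JB -> V) (v : 'I_JH -> V) : set V :=
  [set g | exists (a : R) (al : 'I_JB -> R) (be : 'I_JH -> R),
     g = a *: h + \sum_l al l *: c l + \sum_l be l *: v l].

Definition C_omega (R : realType) d Q B M (JB JH : 'I_M -> nat)
    (F : set (vfun R d Q)) (ip : vfun R d Q -> vfun R d Q -> R)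
    (f0 : vfun R d Q) (b0 : R) (Gam : 'rV[R]_B)
    (c : forall m, 'I_(JB m) -> vfun R d Q) (r : forall m, 'I_(JB m) -> R)
    (v : forall m, 'I_(JH m) -> vfun R d Q) (rho : forall m, 'I_(JH m) -> R)
  : set (vfun R d Q * 'cV[R]_B) :=
  [set fb | F fb.1 /\ forall m : 'I_M,
     exists (g : 'I_(JB m) -> vfun R d Q) (xi : 'I_(JH m) -> R),
     [/\ forall j, span_of (fb.1 - f0) (@c m) (@v m) (g j),
         forall j, 0 <= xi j,
         0 <= - b0 + (Gam *m fb.2) 0 0 + \sum_j ip (g j) (c m j)
              - \sum_j xi j * rho m j - \sum_j r m j * ip_norm ip (g j)
       & - (fb.1 - f0) + \sum_j g j - \sum_j xi j *: v m j = 0]].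

Definition sample_values (R : realType) d Q s N (J : 'I_N -> nat)
    (X : set 'rV[R]_d) (D0 : forall n, 'I_(J n) -> diffop R d Q s)
    (x : 'I_N -> 'rV[R]_d) (f : vfun R d Q) : 'rV[R]_(\sum_n J n) :=
  \mxrow_n \row_j op_at X (D0 n j) f (x n).

Definition loss_S (R : realType) d Q s B N (J : 'I_N -> nat)
    (X : set 'rV[R]_d) (D0 : forall n, 'I_(J n) -> diffop R d Q s)
    (x : 'I_N -> 'rV[R]_d) (ip : vfun R d Q -> vfun R d Q -> R)
    (L : 'cV[R]_B -> 'rV[R]_(\sum_n J n) -> \bar R) (Reg : R -> R)
    (fb : vfun R d Q * 'cV[R]_B) : \bar R :=
  (L fb.2 (sample_values X D0 x fb.1) + (Reg (ip_norm ip fb.1))%:E)%E.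

(* Main.v *)
Require Import Defs.
From HB Require Import structures.
From mathcomp Require Import all_boot all_order all_algebra.
From mathcomp Require Import all_classical all_reals all_analysis.
From mathcomp Require Import ring lra.
Set Implicit Arguments.
Unset Strict Implicit.
Unset Printing Implicit Defensive.
Import Order.TTheory GRing.Theory Num.Theory.
Import numFieldNormedType.Exports.
Local Open Scope classical_set_scope.
Local Open Scope ring_scope.
(* Each derivative D(f)(x) is represented by DK(., x): by the mean value theorem,
   the inner product of two iterated difference quotients of z |-> K(., z) e_q is
   a value of the diagonal derivative d^{r,r} K_qq at nearby points, so its
   continuity makes the difference quotients Cauchy in F_K, also when the points
   tend to the boundary of X.

   Representer theorem: replace f by its orthogonal projection g on the span of
   the listed functions. All sampled values, and all the D_i(f - f0_i)(x_{i,m}),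
   are unchanged, the norms of f and of f - f0_i do not grow, and projecting the
   multipliers g_j of a certificate for f yields a certificate for g.

   Existence: an SOC constraint fails on a weakly open set because the norm is
   weakly l.s.c. For an Omega constraint, the certificates of the points of a weak
   neighbourhood, projected on span(f - f0, c, v), form a bounded family of
   finite-dimensional coordinates, a point of the non-empty open set Omega playing
   the role of a Slater point; by compactness, certificates at points
   approaching (f, b) would give one at (f, b). *)

(** * Inner product spaces *)

(** Smoothness is assumed of [K] alone, so the differentiability of the members of F_K has to be
    produced together with the representers DK(., x). A point x of X need not be interior, hence the
    difference quotients are based at interior points y that merely tend to x, with steps so short
    that every point met by the mean value theorem stays in the interior. A single diagonal entry
    K_qq suffices because ||A - B||^2 = <A,A> - 2<A,B> + <B,B> only pairs sections K(., z) e_q with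
    the same q.

    The multipliers of an Omega constraint lie in a span that moves with f, while a weak
    neighbourhood controls only finitely many functionals. Projecting on the span attached to the
    limit point makes the problem finite-dimensional at a controlled price: the equation of the
    certificate then fails by exactly the pairings <h' - h, e_k>, where h = f - f0, h' is the nearby
    value and the e_k are an orthonormal basis of that span. *)

Record prehilbert (R : realType) (V : lmodType R) (H : set V)
    (ip : V -> V -> R) : Prop := Prehilbert {
  pre0 : H 0;
  pre_lin : forall a x y, H x -> H y -> H (a *: x + y);
  pre_sym : forall x y, H x -> H y -> ip x y = ip y x;
  pre_linl : forall a x y z, H x -> H y -> H z ->
    ip (a *: x + y) z = a * ip x z + ip y z;
  pre_pos : forall x, H x -> x != 0 -> 0 < ip x x }.

Lemma hilbert_pre (R : realType) (V : lmodType R) (H : set V)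
  (ip : V -> V -> R) : is_hilbert H ip -> prehilbert H ip.
Proof. by case. Qed.

Section Prehilbert.
Variables (R : realType) (V : lmodType R) (H : set V) (ip : V -> V -> R).
Hypothesis hH : prehilbert H ip.
Local Notation nrm := (ip_norm ip).

Lemma memD x y : H x -> H y -> H (x + y).
Proof. by move=> hx hy; rewrite -[x]scale1r; exact: (pre_lin hH). Qed.

Lemma memZ a x : H x -> H (a *: x).
Proof. by move=> hx; rewrite -[_ *: _]addr0; apply: (pre_lin hH) => //; case: hH. Qed.

Lemma memN x : H x -> H (- x).
Proof. by move=> hx; rewrite -scaleN1r; exact: memZ. Qed.

Lemma memB x y : H x -> H y -> H (x - y).
Proof. by move=> hx hy; apply: memD => //; exact: memN. Qed.

Lemma mem_sum (I : Type) (s : seq I) (P : pred I) (f : I -> V) :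
  (forall i, P i -> H (f i)) -> H (\sum_(i <- s | P i) f i).
Proof.
by move=> hf; apply: (big_ind H) => //; [case: hH | exact: memD].
Qed.

Lemma ipDl x y z : H x -> H y -> H z -> ip (x + y) z = ip x z + ip y z.
Proof. by move=> *; rewrite -{1}[x]scale1r (pre_linl hH) // mul1r. Qed.

Lemma ip0l z : H z -> ip 0 z = 0.
Proof.
move=> hz; have h0 := pre0 hH.
by apply: (addrI (ip 0 z)); rewrite -ipDl // !addr0.
Qed.

Lemma ipZl a x z : H x -> H z -> ip (a *: x) z = a * ip x z.
Proof.
move=> hx hz; rewrite -[_ *: _]addr0 (pre_linl hH) //; last by case: hH.
by rewrite ip0l // addr0.
Qed.

Lemma ipNl x z : H x -> H z -> ip (- x) z = - ip x z.
Proof. by move=> *; rewrite -scaleN1r ipZl // mulN1r. Qed.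

Lemma ipBl x y z : H x -> H y -> H z -> ip (x - y) z = ip x z - ip y z.
Proof. by move=> *; rewrite ipDl ?ipNl//; exact: memN. Qed.

Lemma ip_suml (I : Type) (s : seq I) (P : pred I) (f : I -> V) z :
  (forall i, P i -> H (f i)) -> H z ->
  ip (\sum_(i <- s | P i) f i) z = \sum_(i <- s | P i) ip (f i) z.
Proof.
move=> hf hz.
suff [] : H (\sum_(i <- s | P i) f i) /\
  ip (\sum_(i <- s | P i) f i) z = \sum_(i <- s | P i) ip (f i) z by [].
apply: (big_ind2 (fun x y => H x /\ ip x z = y)).
- by split; [case: hH | exact: ip0l].
- by move=> x1 x2 y1 y2 [? <-] [? <-]; split; [exact: memD | exact: ipDl].
- by move=> i /hf.
Qed.

Lemma ipDr x y z : H x -> H y -> H z -> ip z (x + y) = ip z x + ip z y.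
Proof. by move=> hx hy hz; rewrite !(pre_sym hH hz) ?ipDl//; exact: memD. Qed.

Lemma ip0r z : H z -> ip z 0 = 0.
Proof. by move=> hz; rewrite (pre_sym hH) ?ip0l//; case: hH. Qed.

Lemma ipZr a x z : H x -> H z -> ip z (a *: x) = a * ip z x.
Proof. by move=> hx hz; rewrite !(pre_sym hH hz) ?ipZl//; exact: memZ. Qed.

Lemma ipNr x z : H x -> H z -> ip z (- x) = - ip z x.
Proof. by move=> hx hz; rewrite !(pre_sym hH hz) ?ipNl//; exact: memN. Qed.

Lemma ipBr x y z : H x -> H y -> H z -> ip z (x - y) = ip z x - ip z y.
Proof. by move=> hx hy hz; rewrite !(pre_sym hH hz) ?ipBl//; exact: memB. Qed.

Lemma ip_sumr (I : Type) (s : seq I) (P : pred I) (f : I -> V) z :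
  (forall i, P i -> H (f i)) -> H z ->
  ip z (\sum_(i <- s | P i) f i) = \sum_(i <- s | P i) ip z (f i).
Proof.
move=> hf hz; rewrite (pre_sym hH) ?ip_suml//; last exact: mem_sum.
by apply: eq_bigr => i /hf hfi; exact: (pre_sym hH).
Qed.

Lemma ip_ge0 x : H x -> 0 <= ip x x.
Proof.
move=> hx; have [->|x0] := eqVneq x 0; first by rewrite ip0l //; case: hH.
exact/ltW/(pre_pos hH).
Qed.

Lemma ip_eq0 x : H x -> ip x x = 0 -> x = 0.
Proof.
move=> hx h0; apply/eqP; apply: contraT => /(pre_pos hH hx).
by rewrite h0 ltxx.
Qed.

Lemma nrm_ge0 x : 0 <= nrm x. Proof. exact: sqrtr_ge0. Qed.

Lemma nrm_sqr x : H x -> nrm x ^+ 2 = ip x x.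
Proof. by move=> hx; rewrite sqr_sqrtr // ip_ge0. Qed.

Lemma nrm_eq0 x : H x -> nrm x = 0 -> x = 0.
Proof. by move=> hx h; apply: ip_eq0 => //; rewrite -nrm_sqr // h expr0n. Qed.

Lemma nrm_gt0 x : H x -> x != 0 -> 0 < nrm x.
Proof. by move=> hx x0; rewrite sqrtr_gt0; exact: (pre_pos hH). Qed.

Lemma nrmZ a x : H x -> nrm (a *: x) = `|a| * nrm x.
Proof.
move=> hx; rewrite /ip_norm ipZl ?ipZr//; last exact: memZ.
by rewrite mulrA -expr2 sqrtrM ?sqr_ge0// sqrtr_sqr.
Qed.

Lemma nrmN x : H x -> nrm (- x) = nrm x.
Proof. by move=> hx; rewrite -scaleN1r nrmZ // normrN1 mul1r. Qed.

Lemma nrmBC x y : H x -> H y -> nrm (x - y) = nrm (y - x).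
Proof. by move=> hx hy; rewrite -nrmN ?opprB//; exact: memB. Qed.

Lemma cauchy_schwarz x y : H x -> H y -> `|ip x y| <= nrm x * nrm y.
Proof.
move=> hx hy; have [->|y0] := eqVneq y 0.
  by rewrite ip0r // normr0 mulr_ge0 ?nrm_ge0.
have yy := pre_pos hH hy y0.
(* [t *: y] is the projection of x on y, and ||x - t y||^2 = <x,x> - <x,y>^2 / <y,y>. *)
pose t := ip x y / ip y y.
have ht : H (x - t *: y) by apply: memB => //; exact: memZ.
have := ip_ge0 ht.
rewrite ipBl ?ipBr ?ipZl ?ipZr//; try exact: memZ; try exact: memB.
rewrite (pre_sym hH hy hx) // => h.
have : ip x y ^+ 2 <= ip x x * ip y y.
  rewrite -subr_ge0 -(pmulr_lge0 _ (_ : 0 < (ip y y)^-1)) ?invr_gt0//.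
  apply: le_trans h _; rewrite le_eqVlt; apply/orP; left; apply/eqP.
  by rewrite /t; field; rewrite gt_eqF.
move=> h2; rewrite -(@ler_pXn2r _ 2) ?nnegrE ?mulr_ge0 ?nrm_ge0//.
by rewrite real_normK ?num_real// exprMn !nrm_sqr.
Qed.

Lemma nrmD x y : H x -> H y -> nrm (x + y) <= nrm x + nrm y.
Proof.
move=> hx hy; rewrite -(@ler_pXn2r _ 2) ?nnegrE ?addr_ge0 ?nrm_ge0//.
rewrite nrm_sqr; last exact: memD.
rewrite ipDl ?ipDr//; last exact: memD.
rewrite sqrrD !nrm_sqr// (pre_sym hH hy hx)//.
have := ler_norm (ip x y); have := cauchy_schwarz hx hy; lra.
Qed.

Lemma nrmB x y : H x -> H y -> nrm (x - y) <= nrm x + nrm y.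
Proof. by move=> hx hy; rewrite -(nrmN hy); apply: nrmD => //; exact: memN. Qed.

Lemma nrm_trans z x y : H x -> H y -> H z ->
  nrm (x - y) <= nrm (x - z) + nrm (z - y).
Proof.
move=> hx hy hz; rewrite -[x - y](subrKA z); apply: nrmD; exact: memB.
Qed.

Lemma ip_le_nrm x y : H x -> H y -> ip x y <= nrm x * nrm y.
Proof. by move=> hx hy; apply: le_trans (ler_norm _) (cauchy_schwarz hx hy). Qed.

Lemma nrm_leP x y : H x -> H y -> (ip x x <= ip y y) -> nrm x <= nrm y.
Proof. by move=> hx hy h; rewrite ler_wsqrtr. Qed.

Lemma pythagoras x y : H x -> H y -> ip x y = 0 -> nrm x <= nrm (x + y).
Proof.
move=> hx hy xy0; apply: nrm_leP => //; first exact: memD.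
rewrite ipDl ?ipDr//; last exact: memD.
by rewrite (pre_sym hH hy hx)// xy0 addr0 add0r lerDl ip_ge0.
Qed.

(** [S] stands for a span with prescribed generators: the new vectors stay in it, so that a
    projection can be written back in those generators. The vectors of [s] may be dependent, hence
    the existential dimension. *)
Lemma gram_schmidt (S : set V) (s : seq V) :
  S `<=` H -> S 0 -> (forall a x y, S x -> S y -> S (a *: x + y)) ->
  (forall x, x \in s -> S x) ->
  exists n (e : 'I_n -> V),
    [/\ forall k, S (e k),
        forall k l, ip (e k) (e l) = (k == l)%:R
      & forall x, x \in s -> x = \sum_k ip x (e k) *: e k].
Proof.
move=> SH S0 Slin; elim: s => [|x s IH] hs.
  by exists 0%N, (fun=> 0); split => // -[].
have [|n [e [eS eo es]]] := IH.
  by move=> y ys; apply: hs; rewrite inE ys orbT.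
have eH k : H (e k) by apply: SH.
have Sx : S x by apply: hs; rewrite mem_head.
pose p := \sum_k ip x (e k) *: e k.
have Sp : S p.
  apply: (big_ind S) => // [y z Sy Sz|k _].
    by rewrite -[y]scale1r; exact: Slin.
  by rewrite -[_ *: _]addr0; exact: Slin.
have Sy : S (x - p) by rewrite addrC -scaleN1r; exact: Slin.
have [xp|y0] := eqVneq (x - p) 0.
  exists n, e; split => // z; rewrite inE => /orP[/eqP ->|]; last exact: es.
  by move/eqP: xp; rewrite subr_eq0 => /eqP.
have ny := nrm_gt0 (SH _ Sy) y0.
have hp k : ip p (e k) = ip x (e k).
  rewrite ip_suml//; last by move=> i _; exact: memZ.
  rewrite (bigD1 k)//= ipZl// eo eqxx mulr1 big1 ?addr0// => i /negPf ik.
  by rewrite ipZl// eo ik mulr0.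
have hy k : ip (x - p) (e k) = 0.
  by rewrite ipBl ?hp ?subrr//; exact: SH.
pose u := (nrm (x - p))^-1 *: (x - p).
have Su : S u by rewrite -[u]addr0; exact: Slin.
have Hu := SH _ Su; have Hp := SH _ Sp; have Hy := SH _ Sy.
have hu k : ip u (e k) = 0 by rewrite ipZl ?hy ?mulr0//; exact: SH.
have hu' k : ip (e k) u = 0 by rewrite (pre_sym hH) ?hu//; exact: SH.
have huu : ip u u = 1.
  rewrite ipZl ?ipZr//; try exact: SH.
  by rewrite -nrm_sqr ?expr2; [field; rewrite gt_eqF|exact: SH].
pose e' (k : 'I_n.+1) := oapp e u (unlift ord0 k).
have e'0 : e' ord0 = u by rewrite /e' unlift_none.
have e'S k : e' (lift ord0 k) = e k by rewrite /e' liftK.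
exists n.+1, e'; split.
- by move=> k; rewrite /e'; case: unliftP => [j|] _ /=.
- move=> k l; rewrite /e'.
  case: unliftP => [i ->|->]; case: unliftP => [j ->|->] /=.
  + by rewrite eo (inj_eq lift_inj).
  + by rewrite hu'.
  + by rewrite hu.
  + by rewrite huu.
- move=> z zs; rewrite big_ord_recl e'0.
  under eq_bigr do rewrite e'S.
  move: zs; rewrite inE => /orP[/eqP ->|zs].
    have -> : ip x u = nrm (x - p).
      have -> : ip x u = ip (x - p + p) u by rewrite subrK.
      rewrite ipDl//.
      have -> : ip p u = 0.
        rewrite ip_suml//; last by move=> i _; exact: memZ.
        by rewrite big1// => k _; rewrite ipZl ?hu' ?mulr0//; exact: SH.
      rewrite addr0 ipZr -?nrm_sqr ?expr2; [|exact: SH..].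
      by field; rewrite gt_eqF.
    rewrite scalerA divff ?gt_eqF// scale1r.
    by rewrite /p subrK.
  have -> : ip z u = 0.
    rewrite (es z zs) ip_suml//; last by move=> i _; exact: memZ.
    by rewrite big1// => k _; rewrite ipZl ?hu' ?mulr0.
  by rewrite scale0r add0r; exact: es.
Qed.

(** * Orthogonal projection on a finite orthonormal family *)

Section Orthonormal.
Variables (n : nat) (e : 'I_n -> V).
Hypothesis (eH : forall k, H (e k)).
Hypothesis (eo : forall k l, ip (e k) (e l) = (k == l)%:R).

Definition oproj x := \sum_k ip x (e k) *: e k.

Lemma mem_oproj x : H (oproj x).
Proof. by apply: mem_sum => k _; exact: memZ. Qed.

Lemma oproj_ip x k : ip (oproj x) (e k) = ip x (e k).
Proof.
rewrite ip_suml//; last by move=> i _; exact: memZ.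
rewrite (bigD1 k)//= ipZl// eo eqxx mulr1 big1 ?addr0// => i /negPf ik.
by rewrite ipZl// eo ik mulr0.
Qed.

Lemma oproj_orth x y : H x -> y = oproj y -> ip (x - oproj x) y = 0.
Proof.
move=> hx ->; rewrite ip_sumr; [|by move=> i _; exact: memZ
  |by apply: memB => //; exact: mem_oproj].
rewrite big1// => k _; rewrite ipZr//; last by apply: memB => //; exact: mem_oproj.
by rewrite ipBl ?oproj_ip ?subrr ?mulr0//; exact: mem_oproj.
Qed.

Lemma oproj_adj x y : H x -> y = oproj y -> ip (oproj x) y = ip x y.
Proof.
move=> hx hy; have hp := mem_oproj x.
have := oproj_orth hx hy; rewrite ipBl//; last first.
  by rewrite hy; exact: mem_oproj.
by move/eqP; rewrite subr_eq0 => /eqP.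
Qed.

Lemma oprojK x : oproj (oproj x) = oproj x.
Proof. by rewrite {1}/oproj; under eq_bigr do rewrite oproj_ip. Qed.

Lemma oproj_nrm x : H x -> nrm (oproj x) <= nrm x.
Proof.
move=> hx; have hp := mem_oproj x.
rewrite -{2}[x](subrKC (oproj x)); apply: pythagoras => //; first exact: memB.
rewrite (pre_sym hH)//; last exact: memB.
by rewrite oproj_orth// oprojK.
Qed.

Lemma ip_coords (a b : 'I_n -> R) :
  ip (\sum_k a k *: e k) (\sum_k b k *: e k) = \sum_k a k * b k.
Proof.
rewrite ip_suml; [|by move=> i _; exact: memZ
  |by apply: mem_sum => i _; exact: memZ].
apply: eq_bigr => k _; rewrite ipZl//; last by apply: mem_sum => i _; exact: memZ.
congr (_ * _); rewrite ip_sumr//; last by move=> i _; exact: memZ.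
rewrite (bigD1 k)//= ipZr// eo eqxx mulr1 big1 ?addr0// => i ik.
by rewrite ipZr// eo eq_sym (negPf ik) mulr0.
Qed.

End Orthonormal.
End Prehilbert.

(** Makes the lemmas above available for the quadratic forms of the Loewner constraints and for the
    parameter b. *)
Lemma dotv_pre (R : realType) n : prehilbert [set: 'cV[R]_n] (@dotv R n).
Proof.
split => //.
- by move=> x y _ _; apply: eq_bigr => i _; rewrite mulrC.
- move=> a x y z _ _ _; rewrite /dotv mulr_sumr -big_split; apply: eq_bigr => i _.
  by rewrite !mxE mulrDl mulrA.
- move=> x _ x0; rewrite lt_neqAle; apply/andP; split; last first.
    by apply: sumr_ge0 => i _; rewrite -expr2 sqr_ge0.
  apply: contraNneq x0 => /esym/eqP h; apply/eqP/matrixP => i j.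
  rewrite ord1 mxE; move: h; rewrite psumr_eq0; last first.
    by move=> k _; rewrite -expr2 sqr_ge0.
  by move=> /allP/(_ i (mem_index_enum _)) /=; rewrite -expr2 sqrf_eq0 => /eqP.
Qed.

(** * Iterated difference quotients *)

Section FiniteDifferences.
Variables (R : realType) (d : nat).
Implicit Types (l : seq (R * 'I_d)) (y z : 'rV[R]_d).
Local Notation dir i := (delta_mx 0 i : 'rV[R]_d).

Definition dquot (W : lmodType R) (t : R) (i : 'I_d) (u : 'rV[R]_d -> W)
  : 'rV[R]_d -> W := fun z => t^-1 *: (u (z + t *: dir i) - u z).

(* The head step is applied first, although the head of a word of iter_partial is
   the last derivative taken: fdiff_mvt can then use the mean value theorem for the
   head step on iter_partial of the tail. *)
Fixpoint fdiff (W : lmodType R) (l : seq (R * 'I_d)) (u : 'rV[R]_d -> W)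
  : 'rV[R]_d -> W :=
  if l is p :: l' then fdiff l' (dquot p.1 p.2 u) else u.

Definition steps_len l : R := \sum_(p <- l) `|p.1|.

Definition cball y (r : R) : set 'rV[R]_d := [set z | `|z - y| <= r].

Lemma fdiff_comb (W : lmodType R) l (a : R) (u1 u2 : 'rV[R]_d -> W) y :
  fdiff l (fun z => a *: (u1 z - u2 z)) y = a *: (fdiff l u1 y - fdiff l u2 y).
Proof.
elim: l u1 u2 => [//|[t i] l IH] u1 u2 /=; rewrite -IH; congr (fdiff l _ y).
apply/funext => z; rewrite /dquot /= -!scalerBr.
rewrite scalerA mulrC -scalerA; congr (a *: (t^-1 *: _)).
rewrite !opprB addrACA [RHS]addrACA.
by congr (_ + _); rewrite addrC.
Qed.

Lemma fdiff_shift (W : lmodType R) l (c : 'rV[R]_d) (u : 'rV[R]_d -> W) y :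
  fdiff l (fun z => u (z + c)) y = fdiff l u (y + c).
Proof.
elim: l u => [//|[t i] l IH] u /=; rewrite -IH; congr (fdiff l _ y).
by apply/funext => z; rewrite /dquot addrAC.
Qed.

(** [fdiff l] is linear and commutes with translations, so the step applied first can be taken out
    as the last one. *)
Lemma fdiff_dquot (W : lmodType R) l t i (u : 'rV[R]_d -> W) y :
  fdiff l (dquot t i u) y = t^-1 *: (fdiff l u (y + t *: dir i) - fdiff l u y).
Proof. by rewrite fdiff_comb fdiff_shift. Qed.

Lemma steps_len_cons p l : steps_len (p :: l) = `|p.1| + steps_len l.
Proof. by rewrite /steps_len big_cons. Qed.

Lemma steps_len_ge0 l : 0 <= steps_len l.
Proof. by apply: sumr_ge0. Qed.

Lemma norm_dir (t : R) (i : 'I_d) : `|t *: dir i| <= `|t|.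
Proof.
rewrite [leLHS]/Num.norm /= mx_normrE; apply/bigmax_leP; split => //= -[j k] _ /=.
rewrite !mxE normrM -[leRHS]mulr1 ler_wpM2l//.
by case: (_ && _); rewrite ?normr1 ?normr0 ?ler01.
Qed.

Section FdiffHilbert.
Variables (V : lmodType R) (H : set V) (ip : V -> V -> R).
Hypothesis hH : prehilbert H ip.

Lemma mem_fdiff l (k : 'rV[R]_d -> V) y : (forall z, H (k z)) -> H (fdiff l k y).
Proof.
elim: l k => [//|[t i] l IH] k hk /=.
by apply: IH => z; apply: (memZ hH); apply: (memB hH).
Qed.

Lemma fdiff_ipr l (k : 'rV[R]_d -> V) f y : H f -> (forall z, H (k z)) ->
  ip f (fdiff l k y) = fdiff (W := R^o) l (fun z => ip f (k z)) y.
Proof.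
move=> hf; elim: l k => [//|[t i] l IH] k hk /=.
rewrite IH; last by move=> z; apply: (memZ hH); apply: (memB hH).
congr (fdiff l _ y); apply/funext => z.
by rewrite (ipZr hH)// ?(ipBr hH)//; apply: (memB hH).
Qed.

Lemma fdiff_ipl l (k : 'rV[R]_d -> V) f y : H f -> (forall z, H (k z)) ->
  ip (fdiff l k y) f = fdiff (W := R^o) l (fun z => ip (k z) f) y.
Proof.
move=> hf hk; rewrite (pre_sym hH)//; last exact: mem_fdiff.
rewrite fdiff_ipr//; congr (fdiff l _ y); apply/funext => z.
exact: (pre_sym hH).
Qed.

End FdiffHilbert.

Lemma iter_partial_eq (U : set 'rV[R]_d) w (u1 u2 : 'rV[R]_d -> R) :
  open U -> (forall z, U z -> u1 z = u2 z) ->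
  forall z, U z -> iter_partial w u1 z = iter_partial w u2 z.
Proof.
move=> oU h; elim: w => [//|i w IH] z Uz /=.
apply: near_eq_derive; near=> x; apply: IH.
by near: x; exact: open_nbhs_nbhs.
Unshelve. all: by end_near. Qed.

Lemma iter_derivable_eq (U : set 'rV[R]_d) w (u1 u2 : 'rV[R]_d -> R) :
  open U -> (forall z, U z -> u1 z = u2 z) ->
  iter_derivable U w u1 -> iter_derivable U w u2.
Proof.
move=> oU h; elim: w => [//|i w IH] /= [/IH h1 h2]; split => // z Uz.
apply: near_eq_derivable (h2 z Uz); near=> x; apply: (iter_partial_eq w oU h).
by near: x; exact: open_nbhs_nbhs.
Unshelve. all: by end_near. Qed.

Lemma iter_derivableS (U U' : set 'rV[R]_d) w (u : 'rV[R]_d -> R) :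
  U' `<=` U -> iter_derivable U w u -> iter_derivable U' w u.
Proof.
by move=> UU'; elim: w => [//|i w IH] /= [/IH h1 h2]; split => // z /UU'/h2.
Qed.

Lemma iter_partial_comb (U : set 'rV[R]_d) w a (u1 u2 : 'rV[R]_d -> R) :
  open U -> iter_derivable U w u1 -> iter_derivable U w u2 ->
  iter_derivable U w (fun z => a * (u1 z - u2 z)) /\
  forall z, U z -> iter_partial w (fun z => a * (u1 z - u2 z)) z =
    a * (iter_partial w u1 z - iter_partial w u2 z).
Proof.
move=> oU; elim: w => [//|i w IH] /= [/IH h1 d1] [/h1 [h2 h3] d2].
have hn z : U z ->
  \near z, a * (iter_partial w u1 z - iter_partial w u2 z) =
           iter_partial w (fun z => a * (u1 z - u2 z)) z.
  by move=> Uz; near=> x; rewrite h3//; near: x; exact: open_nbhs_nbhs.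
split; [split => // z Uz|move=> z Uz].
- apply: near_eq_derivable (hn _ Uz) _.
  exact: (derivableZ (k := a) (derivableB (d1 z Uz) (d2 z Uz))).
- rewrite -(near_eq_derive _ (hn _ Uz)).
  have := deriveZ a (derivableB (d1 z Uz) (d2 z Uz)).
  by rewrite deriveB//; [exact: d1|exact: d2].
Unshelve. all: by end_near. Qed.

Lemma iter_partial_shift w (u : 'rV[R]_d -> R) c :
  iter_partial w (fun z => u (z + c)) = (fun z => iter_partial w u (z + c)).
Proof.
elim: w => [//|i w IH] /=; rewrite IH; apply/funext => z; rewrite /derive /=.
by under eq_fun do rewrite -addrA.
Qed.

Lemma iter_derivable_shift (U : set 'rV[R]_d) w (u : 'rV[R]_d -> R) c :
  iter_derivable U w u ->
  iter_derivable [set z | U (z + c)] w (fun z => u (z + c)).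
Proof.
elim: w => [//|i w IH] /= [/IH h1 h2]; split => // z Uz.
move: (h2 _ Uz); rewrite iter_partial_shift /derivable /=.
by under eq_fun do rewrite addrA.
Qed.

Lemma open_shift (U : set 'rV[R]_d) c : open U -> open [set z | U (z + c)].
Proof.
move=> oU; apply: (@open_comp _ _ (fun z : 'rV[R]_d => z + c) U) => //.
move=> z _; apply: continuousD; first by move=> A; apply.
exact: cst_continuous.
Qed.

Lemma dir_mvt (g : 'rV[R]_d -> R) z (i : 'I_d) (t : R) : t != 0 ->
  (forall a : R, `|a| <= `|t| -> derivable g (z + a *: dir i) (dir i)) ->
  exists2 a, `|a| <= `|t| &
    dquot (W := R^o) t i g z = 'D_(dir i) g (z + a *: dir i).
Proof.
move=> t0 hg.
pose phi (a : R) := g (z + a *: dir i).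
pose dphi a := 'D_(dir i) g (z + a *: dir i).
(* The quotients of [phi] at a are those of g along [dir i], so derivability and the derivative both
   carry over. *)
have eqq a : (fun h : R => h^-1 *: ((phi \o shift a) (h *: (1 : R)) - phi a)) =
  (fun h : R => h^-1 *: ((g \o shift (z + a *: dir i)) (h *: dir i)
     - g (z + a *: dir i))).
  apply/funext => h; congr (_ *: (_ - _)); rewrite /phi /=; congr g.
  have -> : h *: (1 : R) = h by rewrite /GRing.scale /= mulr1.
  by rewrite scalerDl addrCA.
have hphi (a : R) : `|a| <= `|t| -> is_derive a (1 : R) phi (dphi a).
  move=> /hg ha; apply: DeriveDef; first by move: ha; rewrite /derivable eqq.
  by rewrite /dphi /derive eqq.
have key (a b : R) : a <= b -> (forall c, a <= c <= b -> `|c| <= `|t|) ->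
    exists2 c, `|c| <= `|t| & phi b - phi a = dphi c * (b - a).
  move=> ab hc.
  have [||c cab ->] := @MVT_segment R phi dphi a b ab.
  - move=> x /[!in_itv]/= /andP[/ltW ax /ltW xb]; apply: hphi.
    by apply: hc; rewrite ax.
  - apply: derivable_within_continuous => x; rewrite in_itv /= => /hc/hphi.
    by case.
  - by exists c => //; apply: hc; move: cab; rewrite in_itv.
have p0 : phi 0 = g z by rewrite /phi scale0r addr0.
have [tp|tn] := leP 0 t.
  have [c|c hc e] := key 0 t tp.
    by move=> /andP[? ?]; rewrite !ger0_norm.
  exists c => //; rewrite /dquot -p0 -/(phi t) e subr0 /GRing.scale /=.
  by rewrite mulrC mulfK.
have [c|c hc e] := key t 0 (ltW tn).
  by move=> /andP[? ?]; rewrite !ler0_norm ?lerN2 // ltW.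
exists c => //; rewrite /dquot -p0 -/(phi t) -opprB e sub0r mulrN opprK.
by rewrite /GRing.scale /= mulrC mulfK.
Qed.

(** The induction hypothesis, applied to the head quotient, trades the other steps for derivatives
    at some [xi]. These commute with the quotient, and the mean value theorem along the head
    direction removes it. The displacements add up to at most the total length of the steps. *)
Lemma fdiff_mvt l (U : set 'rV[R]_d) (u : 'rV[R]_d -> R) y :
  open U -> iter_derivable U (map snd l) u -> all (fun p => p.1 != 0) l ->
  cball y (steps_len l) `<=` U ->
  exists2 xi, cball y (steps_len l) xi &
    fdiff (W := R^o) l u y = iter_partial (map snd l) u xi.
Proof.
elim: l U u => [|[t i] l IH] U u oU /= hu hl hb.
  by exists y => //; rewrite /cball /= subrr normr0 steps_len_ge0.
case: hu => hu hd; case/andP: hl => t0 hl.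
move: hb; rewrite steps_len_cons /= => hb.
(* Both terms of the head quotient are differentiable on this set. *)
pose U' := U `&` [set z | U (z + t *: dir i)].
have oU' : open U' by apply: openI => //; exact: open_shift.
have d1 : iter_derivable U' (map snd l) (fun z => u (z + t *: dir i)).
  by apply: iter_derivableS (iter_derivable_shift (t *: dir i) hu) => z [].
have d2 : iter_derivable U' (map snd l) u by apply: iter_derivableS hu => z [].
have [h1 h2] := iter_partial_comb t^-1 oU' d1 d2.
have [|xi xiy e] := IH U' (dquot (W := R^o) t i u) oU' h1 hl.
- move=> z hz; split; apply: hb; rewrite /cball /= in hz *.
    by apply: le_trans hz _; rewrite lerDr.
  rewrite addrAC; apply: le_trans (ler_normD _ _) _.
  by rewrite [leRHS]addrC lerD// norm_dir.
- have hb' a : `|a| <= `|t| -> cball y (`|t| + steps_len l) (xi + a *: dir i).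
    move=> ha; rewrite /cball /= addrAC; apply: le_trans (ler_normD _ _) _.
    by rewrite [leRHS]addrC lerD//; apply: le_trans (norm_dir _ _) ha.
  have Uxi : U' xi.
    split; last exact/hb/hb'.
    by have := hb' 0; rewrite scale0r addr0 normr0 normr_ge0 => /(_ isT)/hb.
  have [|a ha ea] := @dir_mvt (iter_partial (map snd l) u) xi i t t0.
    by move=> a /hb'/hb; exact: hd.
  exists (xi + a *: dir i); first exact: hb'.
  by rewrite e h2// -ea /dquot iter_partial_shift.
Qed.

(** A difference operator in the first variable is a finite linear combination of translates, so it
    commutes with derivatives in the second. *)
Lemma fdiff_iter_partial (U : set 'rV[R]_d) l w
    (k : 'rV[R]_d -> 'rV[R]_d -> R) y :
  open U -> cball y (steps_len l) `<=` U ->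
  (forall a, U a -> iter_derivable U w (k a)) ->
  iter_derivable U w (fun b => fdiff (W := R^o) l (k ^~ b) y) /\
  forall z, U z -> iter_partial w (fun b => fdiff (W := R^o) l (k ^~ b) y) z =
    fdiff (W := R^o) l (fun a => iter_partial w (k a) z) y.
Proof.
move=> oU; elim: l y => [|[t i] l IH] y hb hk /=.
  have Uy : U y by apply: hb; rewrite /cball /= subrr normr0 steps_len_ge0.
  by split => //; exact: hk.
move: hb; rewrite steps_len_cons /= => hb.
have [|h1 e1] := IH (y + t *: dir i) _ hk.
  move=> z hz; apply: hb; rewrite /cball /= in hz *.
  rewrite -(subrKA (y + t *: dir i)); apply: le_trans (ler_normD _ _) _.
  by rewrite [leRHS]addrC lerD// addrAC subrr add0r norm_dir.
have [|h2 e2] := IH y _ hk.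
  by move=> z hz; apply: hb; rewrite /cball /=; apply: le_trans hz _; rewrite lerDr.
have [h3 e3] := iter_partial_comb t^-1 oU h1 h2.
have eqf : (fun b => fdiff (W := R^o) l (dquot (W := R^o) t i (k ^~ b)) y) =
  (fun b => t^-1 * (fdiff (W := R^o) l (k ^~ b) (y + t *: dir i)
     - fdiff (W := R^o) l (k ^~ b) y)).
  by apply/funext => b; rewrite fdiff_dquot.
rewrite eqf; split => // z Uz.
by rewrite e3// e1// e2// fdiff_dquot.
Qed.

(** The mean value theorem is applied in the second variable, then in the first. This order matches
    the nesting in [partial2], so mixed derivatives never have to be exchanged. *)
Lemma fdiff2_mvt (U : set 'rV[R]_d) w l l' (k : 'rV[R]_d -> 'rV[R]_d -> R) y y' :
  open U -> map snd l = w -> map snd l' = w ->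
  all (fun p => p.1 != 0) l -> all (fun p => p.1 != 0) l' ->
  cball y (steps_len l) `<=` U -> cball y' (steps_len l') `<=` U ->
  (forall a, U a -> iter_derivable U w (k a)) ->
  (forall b, U b -> iter_derivable U w (fun a => iter_partial w (k a) b)) ->
  exists xi xi', [/\ cball y (steps_len l) xi, cball y' (steps_len l') xi' &
    fdiff (W := R^o) l' (fun b => fdiff (W := R^o) l (k ^~ b) y) y' =
    iter_partial w (fun a => iter_partial w (k a) xi') xi].
Proof.
move=> oU lw lw' hl hl' hb hb' h1 h2.
have [d1 e1] := fdiff_iter_partial oU hb h1.
have [|xi' xiy' ->] := fdiff_mvt oU _ hl' hb'
    (u := fun b => fdiff (W := R^o) l (k ^~ b) y).
  by rewrite lw'.
rewrite lw' e1; last exact: hb'.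
have := fdiff_mvt oU _ hl hb (u := fun a => iter_partial w (k a) xi').
rewrite lw => /(_ (h2 _ (hb' _ xiy'))) [xi xiy ->].
by exists xi, xi'.
Qed.

End FiniteDifferences.

(** * Reproducing property of derivatives *)

Section HilbertDerivatives.
Variables (R : realType) (d : nat) (V : lmodType R) (H : set V).
Variables (ip : V -> V -> R) (U : set 'rV[R]_d) (kap : 'rV[R]_d -> V).
Hypothesis hilb : is_hilbert H ip.
Hypothesis oU : open U.
Hypothesis hkap : forall z, H (kap z).
Local Notation nrm := (ip_norm ip).
Local Notation dir i := (delta_mx 0 i : 'rV[R]_d).
Let hH := hilbert_pre hilb.
Implicit Types (w : seq 'I_d) (l : seq (R * 'I_d)) (x y z : 'rV[R]_d).

(** The base point y may differ from x, which allows x on the boundary of [U]. The whole ball is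
    required in [U] because the mean value theorem locates its points only up to that ball. *)
Definition admissible w x (del : R) y l :=
  [/\ map snd l = w, all (fun p => p.1 != 0) l &
      forall z, cball y (steps_len l) z -> U z /\ `|z - x| < del].

(* Phi is the derivative of word w at x of the H-valued map kap, as the limit of
   its iterated difference quotients; x may lie on the boundary of U. *)
Definition is_wderiv w x (Phi : V) := H Phi /\
  forall e, 0 < e -> exists2 del, 0 < del &
    forall y l, admissible w x del y l -> nrm (fdiff l kap y - Phi) <= e.

Lemma steps_ex w (rho : R) : 0 < rho -> exists l,
  [/\ map snd l = w, all (fun p => p.1 != 0) l & steps_len l < rho].
Proof.
move=> rho0; pose t := rho / (size w).+1%:R.
have t0 : 0 < t by rewrite divr_gt0.
exists [seq (t, i) | i <- w]; split.
- by rewrite -map_comp map_id.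
- by rewrite all_map; apply/allP => i _ /=; rewrite gt_eqF.
- rewrite /steps_len big_map /= big_const_seq count_predT iter_addr addr0.
  rewrite -[ltLHS]mulr_natl.
  by rewrite gtr0_norm// /t mulrCA gtr_pMr// ltr_pdivrMr// mul1r ltr_nat.
Qed.

Lemma ball_sub x : U x -> exists2 r : R, 0 < r & forall z, `|z - x| < r -> U z.
Proof.
move=> Ux; have /nbhs_ballP[r r0 h] : nbhs x U by exact: open_nbhs_nbhs.
by exists r => // z zx; apply: h; rewrite -ball_normE /ball_ /= distrC.
Qed.

Lemma admissible_pt w x (del : R) : U x -> 0 < del ->
  exists l, admissible w x del x l.
Proof.
move=> /ball_sub[r r0 hr] d0.
have m0 : 0 < Num.min r del by rewrite lt_min r0.
have [l [l1 l2 l3]] := steps_ex w m0.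
exists l; split => // z /le_lt_trans/(_ l3); rewrite lt_min => /andP[h1 h2].
by split => //; exact: hr.
Qed.

Lemma admissible_near w x x' (del : R) y l :
  admissible w x' (del - `|x' - x|) y l -> admissible w x del y l.
Proof.
case=> h1 h2 h3; split => // z /h3[Uz hz]; split => //.
rewrite -(subrKA x'); apply: le_lt_trans (ler_normD _ _) _.
by rewrite -ltrBrDr.
Qed.

Lemma admissibleW w x (del del' : R) y l : del' <= del ->
  admissible w x del' y l -> admissible w x del y l.
Proof.
move=> dd [h1 h2 h3]; split => // z /h3[Uz hz]; split => //.
exact: lt_le_trans dd.
Qed.

Lemma admissible_ex w x (del : R) : closure U x -> 0 < del ->
  exists y l, admissible w x del y l.
Proof.
move=> clU d0; have [|y [Uy yx]] := clU (ball x del).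
  exact: nbhsx_ballx.
have {}yx : 0 < del - `|y - x|.
  by move: yx; rewrite -ball_normE /ball_ /= distrC subr_gt0.
have [l hl] := admissible_pt w Uy yx.
by exists y, l; exact: admissible_near hl.
Qed.

(** With A and B the two quotients, <A,A>, <A,B> and <B,B> are values of the mixed derivative near
    (x, x), hence within e^2/4 of [g0]; expanding ||A - B||^2 leaves less than e^2. *)
Lemma fdiff_dist w x (g0 : R) :
  (forall a, U a -> iter_derivable U w (fun b => ip (kap a) (kap b))) ->
  (forall b, U b -> iter_derivable U w
     (fun a => iter_partial w (fun b => ip (kap a) (kap b)) b)) ->
  (forall e, 0 < e -> exists2 del, 0 < del & forall y y', U y -> U y' ->
     `|y - x| < del -> `|y' - x| < del ->
     `|iter_partial w (fun a => iter_partial w (fun b => ip (kap a) (kap b)) y') y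
       - g0| < e) ->
  forall e, 0 < e -> exists2 del, 0 < del & forall y l y' l',
    admissible w x del y l -> admissible w x del y' l' ->
    nrm (fdiff l kap y - fdiff l' kap y') < e.
Proof.
move=> h1 h2 h3 e e0.
have e4 : 0 < e ^+ 2 / 4 by rewrite divr_gt0// exprn_gt0.
have [del d0 hd] := h3 _ e4; exists del => // y l y' l' ad ad'.
have key z m z' m' : admissible w x del z m -> admissible w x del z' m' ->
    `|ip (fdiff m kap z) (fdiff m' kap z') - g0| < e ^+ 2 / 4.
  move=> [a1 a2 a3] [b1 b2 b3].
  rewrite (fdiff_ipr hH)//; last exact: (mem_fdiff hH).
  have -> : (fun b => ip (fdiff m kap z) (kap b)) =
      (fun b => fdiff (W := R^o) m (fun a => ip (kap a) (kap b)) z).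
    by apply/funext => b; rewrite (fdiff_ipl hH).
  have [xi [xi' [c1 c2 ->]]] := fdiff2_mvt oU a1 b1 a2 b2
    (fun v hv => proj1 (a3 v hv)) (fun v hv => proj1 (b3 v hv)) h1 h2.
  by have [? ?] := a3 _ c1; have [? ?] := b3 _ c2; exact: hd.
have hA := mem_fdiff hH l y hkap; have hB := mem_fdiff hH l' y' hkap.
rewrite -(@ltr_pXn2r _ 2) ?nnegrE ?nrm_ge0 ?(ltW e0)//.
rewrite (nrm_sqr hH); last exact: (memB hH).
rewrite (ipBl hH)// ?(ipBr hH)//; last exact: (memB hH).
rewrite (pre_sym hH hB hA).
move: (key _ _ _ _ ad ad) (key _ _ _ _ ad' ad') (key _ _ _ _ ad ad').
by rewrite !ltr_norml => /andP[? ?] /andP[? ?] /andP[? ?]; lra.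
Qed.

Lemma wderiv_ex w x : closure U x ->
  (forall e, 0 < e -> exists2 del, 0 < del & forall y l y' l',
    admissible w x del y l -> admissible w x del y' l' ->
    nrm (fdiff l kap y - fdiff l' kap y') < e) ->
  exists Phi, is_wderiv w x Phi.
Proof.
move=> clU hC.
have hpos (n : nat) : 0 < n.+1%:R^-1 :> R by rewrite invr_gt0.
have /choice[yl hyl] (n : nat) : exists p, admissible w x n.+1%:R^-1 p.1 p.2.
  by have [y [l h]] := admissible_ex w clU (hpos n); exists (y, l).
pose u n := fdiff (yl n).2 kap (yl n).1.
have hu n : H (u n) by exact: (mem_fdiff hH).
have hN (del : R) : 0 < del -> exists N, forall n, (N <= n)%N ->
    admissible w x del (yl n).1 (yl n).2.
  move=> d0; exists (Num.truncn del^-1) => n hn; apply: admissibleW (hyl n).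
  rewrite invf_ple ?posrE//; apply: le_trans (ltW (truncnS_gt _)) _.
  by rewrite ler_nat ltnS.
have [||Phi hPhi cvPhi] := hilbert_complete hilb (u := u) => //.
  move=> e /hC[del d0 hd]; have [N hN'] := hN _ d0; exists N => m n hm hn.
  by apply: hd; exact: hN'.
exists Phi; split => // e e0; have e2 : 0 < e / 2 by rewrite divr_gt0.
have [del d0 hd] := hC _ e2; exists del => // y l ad.
have [N1 hN1] := hN _ d0.
have /cvgrPdist_lt/(_ _ e2)[N2 _ hN2] := cvPhi.
have := hN2 (maxn N1 N2) (leq_maxr _ _); rewrite /= sub0r normrN ger0_norm ?nrm_ge0//.
have /(hd _ _ _ _ ad) := hN1 (maxn N1 N2) (leq_maxl _ _).
move=> h1 h2; apply: le_trans (nrm_trans hH (z := u (maxn N1 N2)) _ _ _) _ => //.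
  exact: (mem_fdiff hH).
by rewrite [leRHS]splitr; apply: lerD; exact: ltW.
Qed.

(** For the empty word the only admissible list is empty, and the quotient at x is [kap x]
    itself. *)
Lemma wderiv_nil x Phi : U x -> is_wderiv [::] x Phi -> kap x = Phi.
Proof.
move=> Ux [hPhi h]; apply/eqP; rewrite -subr_eq0; apply/eqP.
apply: (nrm_eq0 hH); first exact: (memB hH).
apply/eqP; rewrite eq_le nrm_ge0 andbT; apply/ler_addgt0Pr => e e0.
rewrite add0r; have [del d0 hd] := h e e0.
have [l hl] := admissible_pt [::] Ux d0.
by have := hd _ _ hl; case: l hl => // p l [].
Qed.

(** One quotient based at y, with steps short enough for both x and y, is close to [Phi] and to
    [Phi']. *)
Lemma wderiv_cont w x Phi : is_wderiv w x Phi ->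
  forall e, 0 < e -> exists2 del, 0 < del & forall y Phi', U y ->
    `|y - x| < del -> is_wderiv w y Phi' -> nrm (Phi' - Phi) <= e.
Proof.
move=> [hPhi h] e e0; have e2 : 0 < e / 2 by rewrite divr_gt0.
have [del d0 hd] := h _ e2; exists del => // y Phi' Uy yx [hPhi' h'].
have [del' d0' hd'] := h' _ e2.
have m0 : 0 < Num.min del' (del - `|y - x|) by rewrite lt_min d0' subr_gt0.
have [l hl] := admissible_pt w Uy m0.
have /hd' h1 : admissible w y del' y l.
  by apply: admissibleW hl; rewrite ge_min lexx.
have /hd h2 : admissible w x del y l.
  by apply: (@admissible_near w x y); apply: admissibleW hl; rewrite ge_min lexx orbT.
have hf := mem_fdiff hH l y hkap.
apply: le_trans (nrm_trans hH (z := fdiff l kap y) _ _ _) _ => //.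
by rewrite [leRHS]splitr; apply: lerD => //; rewrite (nrmBC hH).
Qed.

(** A quotient for [i :: w] with head step t is the t-quotient of two quotients for [w]; making the
    inner steps small first replaces these two by values of [Phi]. *)
Lemma wderiv_step i w (Phi : 'rV[R]_d -> V) x Phi' : U x ->
  (forall z, U z -> is_wderiv w z (Phi z)) -> is_wderiv (i :: w) x Phi' ->
  forall e, 0 < e -> exists2 del, 0 < del & forall t : R, t != 0 -> `|t| < del ->
    U (x + t *: dir i) /\
    nrm (t^-1 *: (Phi (x + t *: dir i) - Phi x) - Phi') <= e.
Proof.
move=> Ux hPhi [hPhi' h] e e0; have e2 : 0 < e / 2 by rewrite divr_gt0.
have [del0 d0 hd] := h _ e2; have [r r0 hr] := ball_sub Ux.
pose del := Num.min del0 r.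
have dp : 0 < del by rewrite lt_min d0.
exists del => // t t0 td.
have Uxt : U (x + t *: dir i).
  apply: hr; rewrite addrAC subrr add0r; apply: le_lt_trans (norm_dir _ _) _.
  by apply: lt_le_trans td _; rewrite ge_min lexx orbT.
split => //.
have [hPx hx] := hPhi _ Ux; have [hPxt hxt] := hPhi _ Uxt.
(* The inner steps are chosen after t: each replacement costs at most e|t|/4, so both together cost
   e/2 after division by t. *)
have eta0 : 0 < e * `|t| / 4 by rewrite divr_gt0// mulr_gt0// normr_gt0.
have [d1 d10 hd1] := hx _ eta0; have [d2 d20 hd2] := hxt _ eta0.
have rho0 : 0 < Num.min (Num.min d1 d2) (del - `|t|).
  by rewrite !lt_min d10 d20 subr_gt0.
have [l [l1 l2]] := steps_ex w rho0.
rewrite !lt_min -andbA => /and3P[l3 l4 l5].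
have hin z : cball x (`|t| + steps_len l) z -> U z /\ `|z - x| < del0.
  move=> /le_lt_trans/(_ (_ : _ < del)).
  rewrite addrC -ltrBrDr => /(_ l5); rewrite lt_min => /andP[? ?].
  by split => //; exact: hr.
have inl z : cball x (steps_len l) z -> cball x (`|t| + steps_len l) z.
  by move=> hz; apply: le_trans hz _; rewrite lerDr.
have inlt z : cball (x + t *: dir i) (steps_len l) z ->
    cball x (`|t| + steps_len l) z.
  move=> hz; rewrite /cball /= -(subrKA (x + t *: dir i)).
  apply: le_trans (ler_normD _ _) _.
  by rewrite [leRHS]addrC lerD// addrAC subrr add0r norm_dir.
have /hd1 n1 : admissible w x d1 x l.
  split => // z hz; split; first by have [] := hin z (inl z hz).
  exact: le_lt_trans hz l3.
have /hd2 n2 : admissible w (x + t *: dir i) d2 (x + t *: dir i) l.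
  split => // z hz; split; first by have [] := hin z (inlt z hz).
  exact: le_lt_trans hz l4.
have /hd : admissible (i :: w) x del0 x ((t, i) :: l).
  by split; rewrite /= ?l1 ?t0// => z; rewrite steps_len_cons; exact: hin.
rewrite [fdiff _ _ _]fdiff_dquot => n3.
set A := fdiff l kap (x + t *: dir i) in n2 n3; set B := fdiff l kap x in n1 n3.
have hA : H A by exact: (mem_fdiff hH).
have hB : H B by exact: (mem_fdiff hH).
have -> : t^-1 *: (Phi (x + t *: dir i) - Phi x) - Phi' =
    (t^-1 *: (A - B) - Phi') +
    t^-1 *: ((B - Phi x) - (A - Phi (x + t *: dir i))).
  rewrite [RHS]addrAC -scalerDr; congr (_ *: _ - _).
  by rewrite opprB addrA subrKA [RHS]addrC subrKA.
have m1 : H (B - Phi x) by exact: (memB hH).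
have m2 : H (A - Phi (x + t *: dir i)) by exact: (memB hH).
have m3 := memB hH m1 m2.
have m4 : H (t^-1 *: (A - B) - Phi').
  by apply: (memB hH) => //; apply: (memZ hH); exact: (memB hH).
apply: le_trans (nrmD hH m4 (memZ hH _ m3)) _.
rewrite [leRHS]splitr lerD// (nrmZ hH)//.
have tp : 0 < `|t| by rewrite normr_gt0.
rewrite normfV mulrC ler_pdivrMr//.
have := nrmB hH m1 m2; lra.
Qed.

Lemma wderiv_derivable i w (Phi : 'rV[R]_d -> V) x Phi' f : U x -> H f ->
  (forall z, U z -> is_wderiv w z (Phi z)) -> is_wderiv (i :: w) x Phi' ->
  is_derive x (dir i) (fun z => ip f (Phi z)) (ip f Phi').
Proof.
move=> Ux hf hPhi hPhi'; have [m' _] := hPhi'.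
have cv : (fun h : R => h^-1 *: (((fun z => ip f (Phi z)) \o shift x) (h *: dir i)
     - ip f (Phi x))) @ 0^' --> ip f Phi'.
  apply/cvgrPdist_le => e e0.
  have n0 : 0 < nrm f + 1 by rewrite ltr_wpDl// nrm_ge0.
  have [del d0 hd] := wderiv_step Ux hPhi hPhi' (divr_gt0 e0 n0).
  exists del => // t /= td t0; rewrite sub0r normrN in td.
  have [Uxt hn] := hd t t0 td.
  have [mxt _] := hPhi _ Uxt; have [mx _] := hPhi _ Ux.
  have mm := memB hH mxt mx.
  rewrite [t *: _ + x]addrC /GRing.scale /= -(ipBr hH)// -(ipZr hH)//.
  have mz := memZ hH t^-1 mm.
  rewrite -(ipBr hH)//; apply: le_trans (cauchy_schwarz hH hf _) _.
    exact: (memB hH).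
  rewrite (nrmBC hH)//; apply: le_trans (ler_wpM2l (nrm_ge0 _ _) hn) _.
  rewrite mulrCA ger_pMr// ler_pdivrMr// mul1r.
  by rewrite lerDl.
apply: DeriveDef; first by apply/cvg_ex; exists (ip f Phi').
exact: (cvg_lim (@Rhausdorff R) cv).
Qed.

(** [W] is a set of words closed under tails, so that the induction on the word stays inside it; it
    will be the set of words of multi-indices of order at most s. *)
Lemma wderiv_partial (W : seq 'I_d -> Prop) (Phi : seq 'I_d -> 'rV[R]_d -> V) f :
  (forall i w, W (i :: w) -> W w) ->
  (forall w z, W w -> U z -> is_wderiv w z (Phi w z)) -> H f ->
  forall w, W w -> iter_derivable U w (fun z => ip f (kap z)) /\
    forall x, U x -> iter_partial w (fun z => ip f (kap z)) x = ip f (Phi w x).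
Proof.
move=> Wt hPhi hf; elim=> [|i w IH] hw.
  by split => // x Ux; congr (ip f _); apply: wderiv_nil => //; exact: hPhi.
have /IH[h1 h2] := Wt _ _ hw.
have hn x : U x -> \near x, ip f (Phi w x) = iter_partial w (fun z => ip f (kap z)) x.
  by move=> Ux; near=> z; rewrite h2//; near: z; exact: open_nbhs_nbhs.
have hd x : U x -> is_derive x (dir i) (fun z => ip f (Phi w z)) (ip f (Phi (i :: w) x)).
  move=> Ux; apply: wderiv_derivable => //; last exact: hPhi.
  by move=> z Uz; apply: hPhi => //; exact: Wt hw.
split; [split => // x Ux|move=> x Ux /=].
  by apply: near_eq_derivable (hn _ Ux) _; case: (hd _ Ux).
by rewrite -(near_eq_derive _ (hn _ Ux)); case: (hd _ Ux).
Unshelve. all: by end_near. Qed.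

Lemma wderiv_cvg w (Phi : 'rV[R]_d -> V) x Phi0 f : H f ->
  (forall z, U z -> is_wderiv w z (Phi z)) -> is_wderiv w x Phi0 ->
  ip f (Phi y) @[y --> within U (nbhs x)] --> ip f Phi0.
Proof.
move=> hf hPhi h0; have [m0 _] := h0; apply/cvgrPdist_le => e e0.
have n0 : 0 < nrm f + 1 by rewrite ltr_wpDl// nrm_ge0.
have [del d0 hd] := wderiv_cont h0 (divr_gt0 e0 n0).
rewrite near_withinE; apply/nbhs_ballP; exists del => // y.
rewrite -ball_normE /ball_ /= distrC => yx Uy.
have [my _] := hPhi _ Uy.
rewrite -(ipBr hH)//; apply: le_trans (cauchy_schwarz hH hf (memB hH m0 my)) _.
rewrite (nrmBC hH)//.
have hn := hd y _ Uy yx (hPhi _ Uy).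
apply: le_trans (ler_wpM2l (nrm_ge0 _ _) hn) _.
rewrite mulrCA ger_pMr// ler_pdivrMr// mul1r.
by rewrite lerDl.
Qed.

End HilbertDerivatives.

(** The first letter is the first coordinate with a nonzero exponent, and dropping it lowers that
    exponent by one. *)
Lemma mword_tail d (r : 'I_d -> nat) i w : mword r = i :: w ->
  exists2 r' : 'I_d -> nat, (msize r' <= msize r)%N & mword r' = w.
Proof.
move=> h; pose r' j := (r j - (j == i))%N.
exists r'; first by apply: leq_sum => j _; exact: leq_subr.
move: h; rewrite /mword; move: (enum_uniq 'I_d); elim: (enum 'I_d) => //= j e IH.
move=> /andP[je ue]; case rj: (r j) => [|n] /=.
  by rewrite {1}/r' rj sub0n /=; exact: IH.
case=> ji <-; rewrite {1}/r' ji eqxx -ji rj subn1 /=; congr (_ ++ _).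
congr flatten; apply/eq_in_map => k ke; rewrite /r' -ji.
by case: eqVneq ke je => [->->//|_]; rewrite subn0.
Qed.

Lemma dotv_delta (R : realType) n (u : 'cV[R]_n) q : dotv u (delta_mx q 0) = u q 0.
Proof.
rewrite /dotv (bigD1 q)//= mxE !eqxx mulr1 big1 ?addr0// => k /negPf kq.
by rewrite mxE kq mulr0.
Qed.

(** * Riesz representers of derivatives in the RKHS *)

Section Rkhs.
Variables (R : realType) (d Q s : nat) (X : set 'rV[R]_d).
Hypothesis hX : X `<=` closure X°.
Variables (K : mvkern R d Q).
Hypotheses (hK : is_mvkernel X K) (hKs : smooth_kernel X s K).
Variables (F : set (vfun R d Q)) (ip : vfun R d Q -> vfun R d Q -> R).
Hypothesis hF : is_rkhs X K F ip.
Let hilb := rkhs_hilbert hF.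
Let hH := hilbert_pre hilb.

(* Extended by zero, so that <f, kfeat q z> = f z q holds for every z. *)
Definition kfeat q (z : 'rV[R]_d) : vfun R d Q :=
  if z \in X then ksection X K z (delta_mx q 0) else 0.

Lemma mem_kfeat q z : F (kfeat q z).
Proof.
rewrite /kfeat; case: ifPn => [/set_mem zX|_]; last exact: (pre0 hH).
exact: (rkhs_section hF).
Qed.

Lemma kfeat_ip q f z : F f -> ip f (kfeat q z) = f z q 0.
Proof.
move=> hf; rewrite /kfeat; case: ifPn => [/set_mem zX|/negP zX].
  by rewrite (rkhs_reproducing hF)// dotv_delta.
rewrite (ip0r hH)// (rkhs_supp hF hf) ?mxE// => Xz; apply: zX; exact: mem_set.
Qed.

Lemma kfeatE p q a b : X a -> X b -> kfeat q a b p 0 = K b a p q.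
Proof.
move=> Xa Xb; rewrite /kfeat mem_set// /ksection patchT ?inE//.
by rewrite -colE mxE.
Qed.

Lemma kfeat_ipE p q a b : X a -> X b -> ip (kfeat q a) (kfeat p b) = K a b q p.
Proof.
move=> Xa Xb; rewrite kfeat_ip; last exact: mem_kfeat.
by rewrite kfeatE// hK.1// mxE.
Qed.

(** On X the pairing of [kfeat q a] and [kfeat q z] is K_qq(a, z). Continuity of the extension [G]
    at the diagonal point (x, x) makes the quotients Cauchy, also when x is not interior. *)
Lemma kfeat_wderiv q (r : 'I_d -> nat) x : X x -> (msize r <= s)%N ->
  exists Phi, is_wderiv F ip X° (kfeat q) (mword r) x Phi.
Proof.
move=> Xx rs; have [_ /(_ r rs)[h1 h2 [G [cG hG]]]] := hKs q q.
have oX : open X° by exact: open_interior.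
have sX z : X° z -> X z by exact: interior_subset.
have e1 a z : X° a -> X° z -> K a z q q = ip (kfeat q a) (kfeat q z).
  by move=> ? ?; rewrite kfeat_ipE//; exact: sX.
have e2 a z : X° a -> X° z ->
    partial r (fun y => K a y q q) z =
    iter_partial (mword r) (fun b => ip (kfeat q a) (kfeat q b)) z.
  by move=> Xa; apply: iter_partial_eq => // y; exact: e1.
apply: wderiv_ex => //; try exact: mem_kfeat; first exact: hX.
apply: (fdiff_dist hilb oX (mem_kfeat q) (g0 := G (x, x))).
- move=> a Xa; apply: (iter_derivable_eq oX) (h1 a Xa) => z Xz; exact: e1.
- move=> b Xb; apply: (iter_derivable_eq oX) (h2 b Xb) => z Xz; exact: e2.
move=> e e0; move/subspace_continuousP : cG => /(_ (x, x) (conj Xx Xx)).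
move=> /cvgrPdist_lt/(_ _ e0); rewrite near_withinE => -[[A B] /= [nA nB] hAB].
move/nbhs_ballP: nA => [d1 d10 hA]; move/nbhs_ballP: nB => [d2 d20 hB].
exists (Num.min d1 d2); first by rewrite lt_min d10.
move=> y y' Xy Xy'; rewrite !lt_min => /andP[yd1 _] /andP[_ yd2].
have <- : G (y, y') = iter_partial (mword r) (fun a => iter_partial (mword r)
    (fun b => ip (kfeat q a) (kfeat q b)) y') y.
  rewrite hG// /partial2 /partial; apply: (iter_partial_eq _ oX) => // z Xz.
  exact: e2.
rewrite distrC; apply: (hAB (y, y')); last by split; exact: sX.
by split; [apply: hA|apply: hB]; rewrite -ball_normE /ball_ /= distrC.
Qed.

(** Agreement of g with f is asked on the interior only, so that the lemma also applies to the
    entries of K(x', .), whose values outside X are arbitrary. *)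
Lemma partialX_riesz q (r : 'I_d -> nat) x : X x -> (msize r <= s)%N ->
  exists2 Phi, F Phi & forall f g, F f -> (forall y, X° y -> g y = f y q 0) ->
    partialX X r g x = ip f Phi.
Proof.
move=> Xx rs; have oX : open X° by exact: open_interior.
pose W w := exists2 r' : 'I_d -> nat, (msize r' <= s)%N & mword r' = w.
have Wt i w : W (i :: w) -> W w.
  by move=> [r' h1 /mword_tail[r'' h2 <-]]; exists r'' => //; exact: leq_trans h1.
pose Phi w z := xget 0 [set u | is_wderiv F ip X° (kfeat q) w z u].
have hPhi w z : W w -> X z -> is_wderiv F ip X° (kfeat q) w z (Phi w z).
  move=> [r' h <-] Xz; have [u hu] := kfeat_wderiv q Xz h.
  by apply: (xgetPex 0 (P := is_wderiv F ip X° (kfeat q) (mword r') z)); exists u.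
have hPhi' w z : W w -> X° z -> is_wderiv F ip X° (kfeat q) w z (Phi w z).
  by move=> hw Xz; apply: hPhi => //; exact: interior_subset Xz.
have Wr : W (mword r) by exists r.
exists (Phi (mword r) x); first by have [] := hPhi _ _ Wr Xx.
move=> f g hf hg.
have [_ hp] := wderiv_partial hilb oX (mem_kfeat q) Wt hPhi' hf Wr.
have {}hp y : X° y -> partial r g y = ip f (Phi (mword r) y).
  move=> Xy; rewrite -hp//; apply: (iter_partial_eq _ oX) => // z Xz.
  by rewrite kfeat_ip// hg.
rewrite /partialX; case: ifPn => [/set_mem|_]; first exact: hp.
have PF : ProperFilter (within X° (nbhs x)).
  by apply: within_nbhs_proper; exact: hX.
apply: cvg_lim => //.
apply: cvg_trans (wderiv_cvg hilb oX (mem_kfeat q) hf (fun z => hPhi' _ z Wr)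
  (hPhi _ _ Wr Xx)).
apply: near_eq_cvg; rewrite near_withinE; near=> y => Xy.
by rewrite hp.
Unshelve. all: by end_near. Qed.

Lemma op1_riesz q (D : diffop1 R d s) x : X x ->
  exists2 Phi, F Phi & forall f g, F f -> (forall y, X° y -> g y = f y q 0) ->
    op1_at X D g x = ip f Phi.
Proof.
move=> Xx; rewrite /op1_at; case: D => /= ts; elim: ts => [_|t ts IH] /=.
  exists 0; first exact: (pre0 hH).
  by move=> f g hf _; rewrite big_nil (ip0r hH).
move=> /andP[/(partialX_riesz q Xx)[P1 hP1 e1] /IH[P2 hP2 e2]].
exists (t.1 *: P1 + P2); first by apply: (memD hH) => //; exact: (memZ hH).
move=> f g hf hg; rewrite big_cons (e1 f)// (e2 f)//.
by rewrite (ipDr hH) ?(ipZr hH)//; exact: (memZ hH).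
Qed.

(** The representer [Phi q] of D_q is first obtained abstractly. Pairing it with [kfeat p z]
    computes its p-th component at z as D_q applied to K(z, .)_pq, which identifies the combination
    of the [Phi q] with [opK]. *)
Lemma opK_reproducing (D : diffop R d Q s) x : X x ->
  F (opK X D K x) /\ forall f, F f -> op_at X D f x = ip f (opK X D K x).
Proof.
move=> Xx.
have /choice[Phi hPhi] (q : 'I_Q) : exists Phi, F Phi /\
    forall f g, F f -> (forall y, X° y -> g y = f y q 0) ->
    op1_at X (D q).2 g x = ip f Phi.
  by have [Phi ? ?] := op1_riesz q (D q).2 Xx; exists Phi.
have mP q : F ((D q).1 *: Phi q) by apply: (memZ hH); have [] := hPhi q.
suff -> : opK X D K x = \sum_q (D q).1 *: Phi q.
  split; first exact: (mem_sum hH).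
  move=> f hf; rewrite (ip_sumr hH)//; apply: eq_bigr => q _.
  by have [h1 h2] := hPhi q; rewrite (ipZr hH)// -(h2 f (fun y => f y q 0)).
apply/funext => z; rewrite fct_sumE /opK.
have [Xz|Xz] := pselect (X z); last first.
  rewrite patchC; last by rewrite inE.
  rewrite big1// => q _; have [h1 _] := hPhi q.
  by rewrite fctE (rkhs_supp hF h1)// scaler0.
rewrite patchT ?inE//; apply: eq_bigr => q _; congr (_ *: _).
have [h1 h2] := hPhi q.
apply/matrixP => p j; rewrite ord1 -colE !mxE.
rewrite (h2 (kfeat p z)); [|exact: mem_kfeat|].
  by rewrite (pre_sym hH) ?kfeat_ip//; exact: mem_kfeat.
move=> y /interior_subset Xy; rewrite kfeatE// hK.1// mxE//.
Qed.

End Rkhs.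

(** * Projection of the constraints *)

Lemma loewner_leW (R : realType) n (A : 'M[R]_n) (e e' : R) : e' <= e ->
  loewner_le e%:M A -> loewner_le e'%:M A.
Proof.
move=> ee [h1 h2]; rewrite /loewner_le; have -> : A - e'%:M = (A - e%:M) + (e - e')%:M.
  by rewrite raddfB /= subrKA.
have hD := @dotv_pre R n.
split; first by rewrite linearD /= h1 tr_scalar_mx.
move=> u; rewrite mulmxDl (ipDr hD)// addr_ge0// mul_scalar_mx (ipZr hD)//.
by rewrite mulr_ge0 ?subr_ge0// (ip_ge0 hD).
Qed.

Lemma zmod_swap (V : zmodType) (p w x y t : V) :
  - (w + p) + (x + t) - y = 0 -> - p + x - y = w - t.
Proof.
move=> h; apply/eqP; rewrite -subr_eq0 -h opprB; apply/eqP.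
rewrite addrC [t - w]addrC opprD -!addrA; congr (_ + _).
by rewrite [LHS]addrCA [t + _]addrCA.
Qed.

Section Certificate.
Variables (R : realType) (V : lmodType R) (H : set V) (ip : V -> V -> R).
Hypothesis hH : prehilbert H ip.
Variables (JB JH : nat) (c : 'I_JB -> V) (r : 'I_JB -> R).
Variables (v : 'I_JH -> V) (rho : 'I_JH -> R).
Hypotheses (hc : forall j, H (c j)) (hv : forall j, H (v j)).
Hypothesis hr : forall j, 0 < r j.
Local Notation nrm := (ip_norm ip).

(** A Lagrange dual certificate of <h, g> >= - beta on Omega: one index m of [C_omega], with h = f -
    f0 and beta = - b0 + Gam b. *)
Definition certificate (h : V) (beta : R) : Prop :=
  exists (g : 'I_JB -> V) (xi : 'I_JH -> R),
    [/\ forall j, span_of h c v (g j), forall j, 0 <= xi j,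
        0 <= beta + \sum_j ip (g j) (c j) - \sum_j xi j * rho j
             - \sum_j r j * nrm (g j)
      & - h + \sum_j g j - \sum_j xi j *: v j = 0].

Lemma mem_span h g : H h -> span_of h c v g -> H g.
Proof.
move=> hh [a [al [be ->]]]; apply: (memD hH); first apply: (memD hH).
- exact: (memZ hH).
- by apply: (mem_sum hH) => l _; exact: (memZ hH).
- by apply: (mem_sum hH) => l _; exact: (memZ hH).
Qed.

Lemma span_orth h g w : H h -> H w -> ip w h = 0 ->
  (forall j, ip w (c j) = 0) -> (forall j, ip w (v j) = 0) ->
  span_of h c v g -> ip w g = 0.
Proof.
move=> hh hw oh oc ov [a [al [be ->]]].
have mc : H (\sum_l al l *: c l) by apply: (mem_sum hH) => l _; exact: (memZ hH).
have mv : H (\sum_l be l *: v l) by apply: (mem_sum hH) => l _; exact: (memZ hH).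
have ma := memZ hH a hh.
rewrite (ipDr hH)//; last exact: (memD hH).
rewrite (ipDr hH)// (ipZr hH)// oh mulr0 add0r.
rewrite !(ip_sumr hH)//; try by move=> *; exact: (memZ hH).
by rewrite !big1 ?addr0// => l _; rewrite (ipZr hH)// ?oc ?ov mulr0.
Qed.

(** As [h - h'] is orthogonal to h', c and v, writing h' for h in the combinations projects the
    multipliers: pairings with the c_j are kept and norms do not grow. *)
Lemma certificate_proj h h' beta : H h -> H h' -> ip (h - h') h' = 0 ->
  (forall j, ip (h - h') (c j) = 0) -> (forall j, ip (h - h') (v j) = 0) ->
  certificate h beta -> certificate h' beta.
Proof.
move=> hh hh' oh oc ov [gj [xi [hs hxi hval heq]]].
have mw : H (h - h') by exact: (memB hH).
have /choice[a /choice[al /choice[be hgj]]] := hs.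
pose gj' j := a j *: h' + \sum_l al j l *: c l + \sum_l be j l *: v l.
have sgj' j : span_of h' c v (gj' j) by exists (a j), (al j), (be j).
have mgj' j : H (gj' j) by exact: (mem_span hh').
have mz t : H (t *: (h - h')) by exact: (memZ hH).
have egj j : gj j = gj' j + a j *: (h - h').
  by rewrite hgj /gj' -{1}[h](subrK h') scalerDr -!addrA addrC -!addrA.
have ogj j : ip (h - h') (gj' j) = 0 by exact: span_orth (sgj' j).
exists gj', xi; split => //.
- apply: le_trans hval _; apply: lerD; last first.
    rewrite lerN2; apply: ler_sum => j _; rewrite ler_wpM2l ?(ltW (hr _))//.
    rewrite egj; apply: (pythagoras hH) => //.
    by rewrite (pre_sym hH)// (ipZl hH)// ogj mulr0.
  rewrite lerD2r lerD2l le_eqVlt; apply/orP; left; apply/eqP.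
  apply: eq_bigr => j _.
  by rewrite egj (ipDl hH)// (ipZl hH)// oc mulr0 addr0.
- have mxi : H (\sum_j xi j *: v j) by apply: (mem_sum hH) => j _; exact: (memZ hH).
  have sgj : \sum_j gj j = \sum_j gj' j + (\sum_j a j) *: (h - h').
    by rewrite scaler_suml -big_split; apply: eq_bigr => j _; exact: egj.
  have msg : H (\sum_j gj' j) by exact: (mem_sum hH).
  have mN := memN hH hh'; have mNs := memD hH mN msg.
  (* The new residual is a multiple of [h - h'] and orthogonal to it, hence zero. *)
  set E := - h' + _ - _.
  have eE : E = (1 - \sum_j a j) *: (h - h').
    rewrite scalerBl scale1r; apply: (zmod_swap (p := h')).
    by rewrite subrK -sgj.
  have oE : ip (h - h') E = 0.
    rewrite (ipBr hH)// (ipDr hH)// (ipNr hH)// oh oppr0 add0r.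
    rewrite !(ip_sumr hH)//; last by move=> j _; exact: (memZ hH).
    by rewrite !big1 ?subr0// => j _; rewrite ?ogj ?(ipZr hH)// ?ov ?mulr0.
  move: oE; rewrite eE (ipZr hH)// => /eqP; rewrite mulf_eq0 => /orP[/eqP ->|].
    by rewrite scale0r.
  by move=> /eqP /(ip_eq0 hH mw) ->; rewrite scaler0.
Qed.

End Certificate.

Section Projection.
Variables (R : realType) (d Q s B : nat) (X : set 'rV[R]_d).
Hypothesis hX : X `<=` closure X°.
Variables (nu : 'rV[R]_d -> R) (K : mvkern R d Q).
Hypotheses (hnu : is_norm nu) (hK : is_mvkernel X K) (hKs : smooth_kernel X s K).
Variables (F : set (vfun R d Q)) (ip : vfun R d Q -> vfun R d Q -> R).
Hypothesis hF : is_rkhs X K F ip.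
Let hilb := rkhs_hilbert hF.
Let hH := hilbert_pre hilb.
Local Notation nrm := (ip_norm ip).

Lemma op_at_eq (D : diffop R d Q s) x f g : X x -> F f -> F g ->
  ip (f - g) (opK X D K x) = 0 -> op_at X D f x = op_at X D g x.
Proof.
move=> Xx hf hg; have [hm hr] := opK_reproducing hX hK hKs hF D Xx.
by rewrite !hr// (ipBl hH)// => /eqP; rewrite subr_eq0 => /eqP.
Qed.

Lemma op_atB (D : diffop R d Q s) x f g : X x -> F f -> F g ->
  op_at X D (f - g) x = op_at X D f x - op_at X D g x.
Proof.
move=> Xx hf hg; have [hm hr] := opK_reproducing hX hK hKs hF D Xx.
by rewrite !hr ?(ipBl hH)//; exact: (memB hH).
Qed.

(** The centre of the ball, with a coordinate vector as u, shows that the supremum is not over the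
    empty set, where it would be -oo. *)
Lemma eta_soc_ge0 P (D : 'I_P -> 'I_P -> diffop R d Q s) x del :
  (0 < P)%N -> X x -> 0 < del -> (0 <= eta_soc X nu K ip D x del)%E.
Proof.
move=> P0 Xx d0; apply: le_trans (ereal_sup_ubound _); last first.
  exists (x, delta_mx (Ordinal P0) 0); last by [].
  split => /=.
    split => //; rewrite subrr; case: hnu => _ _ /(_ 0 0) + _.
    by rewrite scale0r normr0 mul0r => ->; exact: ltW.
  rewrite /unit_sphere /= /l2norm (bigD1 (Ordinal P0))//= big_ord1 mxE !eqxx.
  rewrite big1 ?addr0 ?expr1n ?sqrtr1// => i iP.
  by rewrite big_ord1 mxE (negPf iP) expr0n.
by rewrite lee_fin sqrtr_ge0.
Qed.

Lemma C_soc_proj P M (D : 'I_P -> 'I_P -> diffop R d Q s) f0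
    (b0 : 'cV[R]_P) (Gam : 'M[R]_(P, B)) (xt : 'I_M -> 'rV[R]_d) del f g b :
  (0 < P)%N -> (forall m, X (xt m)) -> (forall m, 0 < del m) ->
  F f0 -> F f -> F g -> nrm (g - f0) <= nrm (f - f0) ->
  (forall p1 p2 m, ip (f - g) (opK X (D p1 p2) K (xt m)) = 0) ->
  C_soc X nu K F ip D f0 b0 Gam xt del (f, b) ->
  C_soc X nu K F ip D f0 b0 Gam xt del (g, b).
Proof.
move=> P0 hxt hdel hf0 hf hg hn ho [_ hm]; split; first exact: hg.
move=> m; have /= [e he hL] := hm m; rewrite /=.
have eta0 := eta_soc_ge0 D P0 (hxt m) (hdel m).
have -> : opmx X D (g - f0) (xt m) = opmx X D (f - f0) (xt m).
  apply/matrixP => p1 p2; rewrite !mxE !op_atB//; congr (_ - _).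
  by apply/esym/op_at_eq.
move: he eta0; case: (eta_soc _ _ _ _ _ _ _) => [h|/=|//].
  move=> [he]; rewrite lee_fin => h0; exists (h * nrm (g - f0)) => //.
  by apply: loewner_leW hL; rewrite -he ler_wpM2l.
(* Here eta is +oo: the product is finite only if [nrm (f - f0)] vanishes, and then [nrm (g - f0)]
   vanishes too. *)
have [f00|n0] := eqVneq (nrm (f - f0)) 0.
  move=> he _; exists e => //; rewrite -he f00.
  by congr (_ * _%:E)%E; apply/eqP; rewrite eq_le -{1}f00 hn nrm_ge0.
by rewrite mulyr gtr0_sg ?mul1e// lt_neqAle eq_sym n0 nrm_ge0.
Qed.

Lemma C_omega_proj M (JB JH : 'I_M -> nat) f0 b0 (Gam : 'rV[R]_B)
    (c : forall m, 'I_(JB m) -> vfun R d Q) (r : forall m, 'I_(JB m) -> R)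
    (v : forall m, 'I_(JH m) -> vfun R d Q) (rho : forall m, 'I_(JH m) -> R)
    f g b :
  F f0 -> (forall m j, F (c m j)) -> (forall m j, F (v m j)) ->
  (forall m j, 0 < r m j) -> F f -> F g ->
  ip (f - g) (g - f0) = 0 ->
  (forall m j, ip (f - g) (c m j) = 0) -> (forall m j, ip (f - g) (v m j) = 0) ->
  C_omega F ip f0 b0 Gam c r v rho (f, b) ->
  C_omega F ip f0 b0 Gam c r v rho (g, b).
Proof.
move=> hf0 hc hv hr hf hg og oc ov [_ hm]; split; first exact: hg.
move=> m; have efg : f - g = (f - f0) - (g - f0) by rewrite opprB subrKA.
rewrite efg in og oc ov.
have mf := memB hH hf hf0; have mg := memB hH hg hf0.
exact: (certificate_proj hH (hc m) (hv m) (hr m) mf mg og (oc m) (ov m) (hm m)).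
Qed.

Lemma sample_values_eq N (J : 'I_N -> nat) (D0 : forall n, 'I_(J n) -> diffop R d Q s)
    (x : 'I_N -> 'rV[R]_d) f g : (forall n, X (x n)) -> F f -> F g ->
  (forall n j, ip (f - g) (opK X (D0 n j) K (x n)) = 0) ->
  sample_values X D0 x f = sample_values X D0 x g.
Proof.
move=> hx hf hg h; apply/matrixP => i k; rewrite !mxE.
exact: op_at_eq.
Qed.

End Projection.

(** The orthonormal vectors are combinations of the [u t], so the projection of f is one as well;
    each [u t] is its own projection, hence orthogonal to the remainder. *)
Lemma lincomb_proj (R : realType) (V : lmodType R) (H : set V)
    (ip : V -> V -> R) (T : finType) (u : T -> V) f :
  prehilbert H ip -> (forall t, H (u t)) -> H f ->
  exists a : T -> R, forall t, ip (f - \sum_t a t *: u t) (u t) = 0.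
Proof.
move=> hH hu hf.
pose S := [set g | exists a : T -> R, g = \sum_t a t *: u t].
have SH : S `<=` H.
  by move=> _ [a ->]; apply: (mem_sum hH) => t _; exact: (memZ hH).
have [|||n [e [eS eo es]]] := @gram_schmidt _ _ _ _ hH S [seq u t | t <- enum T] SH.
- by exists (fun=> 0); rewrite big1// => t _; rewrite scale0r.
- move=> b _ _ [a ->] [a' ->]; exists (fun t => b * a t + a' t).
  rewrite scaler_sumr -big_split; apply: eq_bigr => t _ /=.
  by rewrite scalerDl scalerA.
- move=> _ /mapP[t _ ->]; exists (fun t' => (t' == t)%:R).
  rewrite (bigD1 t)//= eqxx scale1r big1 ?addr0// => t' /negPf ->.
  by rewrite scale0r.
have eH k : H (e k) by exact: SH.
have [a ha] : S (oproj ip e f).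
  have /choice[a ha] := eS.
  exists (fun t => \sum_k ip f (e k) * a k t).
  rewrite /oproj; under [RHS]eq_bigr do rewrite scaler_suml.
  rewrite exchange_big; apply: eq_bigr => k _ /=.
  by rewrite {2}ha scaler_sumr; apply: eq_bigr => t _; rewrite scalerA.
exists a => t; rewrite -ha; apply: (oproj_orth hH) => //.
by apply: es; rewrite map_f// mem_enum.
Qed.

Lemma sum_tagged (V : nmodType) (I : finType) (J : I -> finType)
    (G : {i : I & J i} -> V) :
  \sum_t G t = \sum_i \sum_j G (existT _ i j).
Proof.
by rewrite (sig_big_dep _ _ (fun i j => G (Tagged J j))); apply: eq_bigr => -[].
Qed.

(** * Representer theorem: one projection serving the loss and all constraints *)

Section Representer.
Variables (R : realType) (d Q B s : nat) (X : set 'rV[R]_d).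
Hypothesis hX : X `<=` closure X°.
Variables (nu : 'rV[R]_d -> R) (K : mvkern R d Q).
Hypotheses (hnu : is_norm nu) (hK : is_mvkernel X K) (hKs : smooth_kernel X s K).
Variables (F : set (vfun R d Q)) (ip : vfun R d Q -> vfun R d Q -> R).
Hypothesis hF : is_rkhs X K F ip.
Let hilb := rkhs_hilbert hF.
Let hH := hilbert_pre hilb.
Local Notation nrm := (ip_norm ip).

Lemma representer (nI : nat) (ISOC IOm : {set 'I_nI})
    (P : 'I_nI -> nat) (hP : forall i, (0 < P i)%N)
    (D : forall i, 'I_(P i) -> 'I_(P i) -> diffop R d Q s)
    (f0 : 'I_nI -> vfun R d Q) (hf0 : forall i, F (f0 i))
    (b0 : forall i, 'cV[R]_(P i)) (Gam : forall i, 'M[R]_(P i, B))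
    (M : 'I_nI -> nat)
    (xt : forall i, 'I_(M i) -> 'rV[R]_d) (del : forall i, 'I_(M i) -> R)
    (hxt : forall i m, i \in ISOC -> X (xt i m))
    (hdel : forall i m, i \in ISOC -> 0 < del i m)
    (JB JH : forall i, 'I_(M i) -> nat)
    (c : forall i m, 'I_(JB i m) -> vfun R d Q)
    (r : forall i m, 'I_(JB i m) -> R)
    (v : forall i m, 'I_(JH i m) -> vfun R d Q)
    (rho : forall i m, 'I_(JH i m) -> R)
    (hc : forall i m j, i \in IOm -> F (c i m j))
    (hr : forall i m j, i \in IOm -> 0 < r i m j)
    (hv : forall i m j, i \in IOm -> F (v i m j))
    (N : nat) (J : 'I_N -> nat) (x : 'I_N -> 'rV[R]_d) (hx : forall n, X (x n))
    (D0 : forall n, 'I_(J n) -> diffop R d Q s) f :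
  F f -> exists g
     (aL : forall n, 'I_(J n) -> R)
     (aS : forall i, 'I_(P i) -> 'I_(P i) -> 'I_(M i) -> R)
     (aB : forall i m, 'I_(JB i m) -> R)
     (aH : forall i m, 'I_(JH i m) -> R)
     (a0 : 'I_nI -> R),
  [/\ g = \sum_n \sum_j aL n j *: opK X (D0 n j) K (x n)
       + \sum_(i in ISOC) \sum_p1 \sum_p2 \sum_m
           aS i p1 p2 m *: opK X (D i p1 p2) K (xt i m)
       + \sum_(i in IOm) \sum_m
           (\sum_j aB i m j *: c i m j + \sum_j aH i m j *: v i m j)
       + \sum_i a0 i *: f0 i,
      F g /\ nrm g <= nrm f,
      sample_values X D0 x f = sample_values X D0 x g,
      forall i b, i \in ISOC ->
       C_soc X nu K F ip (@D i) (f0 i) (b0 i) (Gam i) (@xt i) (@del i) (f, b) ->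
       C_soc X nu K F ip (@D i) (f0 i) (b0 i) (Gam i) (@xt i) (@del i) (g, b)
    & forall i b, i \in IOm ->
       C_omega F ip (f0 i) (b0 i (Ordinal (hP i)) 0)
         (row (Ordinal (hP i)) (Gam i)) (@c i) (@r i) (@v i) (@rho i) (f, b) ->
       C_omega F ip (f0 i) (b0 i (Ordinal (hP i)) 0)
         (row (Ordinal (hP i)) (Gam i)) (@c i) (@r i) (@v i) (@rho i) (g, b)].
Proof.
move=> hf.
(* All generators are merged into one family, so that the remainder of a single projection is
   orthogonal to all of them at once. *)
pose TL : finType := {n : 'I_N & 'I_(J n)}.
pose TS : finType := {i : 'I_nI & 'I_(P i) * ('I_(P i) * 'I_(M i))}%type.
pose TB : finType := {i : 'I_nI & {m : 'I_(M i) & 'I_(JB i m)}}.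
pose TH : finType := {i : 'I_nI & {m : 'I_(M i) & 'I_(JH i m)}}.
pose uL (t : TL) := opK X (D0 (tag t) (tagged t)) K (x (tag t)).
(* Membership in [F] is known only for indices in the relevant class; the value 0 elsewhere keeps
   the family in [F] and drops those terms from the sum. *)
pose uS (t : TS) := if tag t \in ISOC then
  opK X (D (tag t) (tagged t).1 (tagged t).2.1) K (xt (tag t) (tagged t).2.2) else 0.
pose uB (t : TB) := if tag t \in IOm then
  c (tag t) (tag (tagged t)) (tagged (tagged t)) else 0.
pose uH (t : TH) := if tag t \in IOm then
  v (tag t) (tag (tagged t)) (tagged (tagged t)) else 0.
pose u (t : TL + TS + (TB + TH) + 'I_nI) := match t with
  | inl (inl (inl t)) => uL t | inl (inl (inr t)) => uS t
  | inl (inr (inl t)) => uB t | inl (inr (inr t)) => uH t | inr i => f0 i end.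
have h0 : F 0 by exact: (pre0 hH).
have hu t : F (u t).
  case: t => [[[t|t]|[t|t]]|i] //=.
  - by have [] := opK_reproducing hX hK hKs hF (D0 (tag t) (tagged t)) (hx (tag t)).
  - rewrite /uS; case: ifP => // ti.
    by have [] := opK_reproducing hX hK hKs hF (D (tag t) (tagged t).1 (tagged t).2.1)
      (hxt _ (tagged t).2.2 ti).
  - by rewrite /uB; case: ifP => // ti; exact: hc.
  - by rewrite /uH; case: ifP => // ti; exact: hv.
have [a ha] := lincomb_proj hH hu hf.
set g := \sum_t a t *: u t in ha.
have mau t : F (a t *: u t) by exact: (memZ hH).
have hg : F g by exact: (mem_sum hH).
have mfg : F (f - g) by exact: (memB hH).
have og : ip (f - g) g = 0.
  rewrite {2}/g (ip_sumr hH)// big1// => t _.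
  by rewrite (ipZr hH)// ha mulr0.
(* As [f0 i] is a generator, [g - f0 i] is the projection of [f - f0 i]; this is why the expansion
   contains the [f0 i]. *)
have ogf i : ip (f - g) (g - f0 i) = 0.
  by rewrite (ipBr hH)// og (ha (inr i)) subrr.
exists g, (fun n j => a (inl (inl (inl (existT _ n j))))),
  (fun i p1 p2 m => a (inl (inl (inr (existT _ i (p1, (p2, m))))))),
  (fun i m j => a (inl (inr (inl (existT _ i (existT _ m j)))))),
  (fun i m j => a (inl (inr (inr (existT _ i (existT _ m j)))))),
  (fun i => a (inr i)); split.
- rewrite /g !big_sumType /=; congr (_ + _); congr (_ + _); first congr (_ + _).
  + exact: sum_tagged.
  + rewrite sum_tagged [RHS]big_mkcond; apply: eq_bigr => i _; rewrite /uS /=.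
    case: ifP => iS; last by rewrite big1// => t _; rewrite scaler0.
    under [RHS]eq_bigr do rewrite pair_bigA.
    by rewrite pair_bigA; apply: eq_bigr => -[p1 [p2 m]].
  + rewrite !sum_tagged -big_split [RHS]big_mkcond; apply: eq_bigr => i _.
    rewrite /uB /uH /=; case: ifP => iO; last first.
      by rewrite !big1 ?addr0// => t _; rewrite scaler0.
    by rewrite !sum_tagged -big_split.
- split => //; rewrite -[f](subrK g) addrC; apply: (pythagoras hH) => //.
  by rewrite (pre_sym hH).
- apply: (sample_values_eq hX hK hKs hF) => // n j.
  exact: (ha (inl (inl (inl (existT _ n j))))).
- move=> i b iS; apply: (C_soc_proj hX hnu hK hKs hF) => //.
  + by move=> m; exact: hxt.
  + by move=> m; exact: hdel.
  + have mm : F (g - f0 i) by exact: (memB hH).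
    have -> : f - f0 i = (g - f0 i) + (f - g) by rewrite [RHS]addrC subrKA.
    by apply: (pythagoras hH) => //; rewrite (pre_sym hH).
  + move=> p1 p2 m; have := ha (inl (inl (inr (existT _ i (p1, (p2, m)))))).
    by rewrite /= /uS /= iS.
- move=> i b iO; apply: (C_omega_proj hF) => //.
  + by move=> m j; exact: hc.
  + by move=> m j; exact: hv.
  + by move=> m j; exact: hr.
  + move=> m j; have := ha (inl (inr (inl (existT _ i (existT _ m j))))).
    by rewrite /= /uB /= iO.
  + move=> m j; have := ha (inl (inr (inr (existT _ i (existT _ m j))))).
    by rewrite /= /uH /= iO.
Qed.

End Representer.

(** * Weak topology *)

Section RealLimits.
Context (R : realType) (T : Type) (F : set_system T) {FF : Filter F}.

Lemma cvg_fsum (I : Type) (s : seq I) (f : I -> T -> R) (l : I -> R) :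
  (forall i, f i x @[x --> F] --> l i) ->
  \sum_(i <- s) f i x @[x --> F] --> \sum_(i <- s) l i.
Proof.
move=> h; elim: s => [|i s IH].
  by under eq_cvg do rewrite big_nil; rewrite big_nil; exact: cvg_cst.
under eq_cvg do rewrite big_cons; rewrite big_cons.
exact: cvgD (h i) IH.
Qed.

Lemma cvg_cstD (a : R) (f : T -> R) (l : R) :
  f x @[x --> F] --> l -> a + f x @[x --> F] --> a + l.
Proof. by move=> h; apply: cvgD h; exact: cvg_cst. Qed.

Lemma cvg_cstM (a : R) (f : T -> R) (l : R) :
  f x @[x --> F] --> l -> a * f x @[x --> F] --> a * l.
Proof. by move=> h; apply: cvgM h; exact: cvg_cst. Qed.

Lemma cvg_Mcst (a : R) (f : T -> R) (l : R) :
  f x @[x --> F] --> l -> f x * a @[x --> F] --> l * a.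
Proof. by move=> h; apply: cvgM; [exact: h|exact: cvg_cst]. Qed.

End RealLimits.

(** A minimum below every positive number is at most 0. Coordinates indexed by [T] are moved to row
    vectors to apply the extreme value theorem. *)
Lemma compact_box_le0 (R : realType) (T : finType) (A : T -> set R)
    (Psi : (T -> R) -> R) :
  (forall t, compact (A t)) ->
  continuous (fun z : 'rV[R]_#|T| => Psi (fun t => z 0 (enum_rank t))) ->
  (forall del, 0 < del -> exists2 z, (forall t, A t (z t)) & Psi z <= del) ->
  exists2 z, (forall t, A t (z t)) & Psi z <= 0.
Proof.
move=> cA cPsi h.
pose Z := [set z : 'rV[R]_#|T| | forall i, A (enum_val i) (z 0 i)].
have cZ : compact Z by apply: (@rV_compact _ _ (fun i => A (enum_val i))).
have h' del : 0 < del -> exists2 z, Z z & Psi (fun t => z 0 (enum_rank t)) <= del.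
  move=> /h[z hz hd]; exists (\row_i z (enum_val i)).
    by move=> i /=; rewrite mxE.
  by under eq_fun do rewrite mxE enum_rankK.
have [|cc /set_mem hcc hmin] := EVT_min_rV _ cZ (continuous_subspaceT cPsi).
  by have [z ? _] := h' 1 ltr01; exists z.
exists (fun t => cc 0 (enum_rank t)).
  by move=> t; have := hcc (enum_rank t); rewrite enum_rankK.
apply/ler_addgt0Pr => del /h'[z hz hd]; rewrite add0r.
by apply: le_trans hd; apply: hmin; exact: mem_set.
Qed.

(** * Weak closedness of the set of certified pairs *)

Section CertificateClosed.
Variables (R : realType) (V : lmodType R) (H : set V) (ip : V -> V -> R).
Hypothesis hH : prehilbert H ip.
Variables (JB JH : nat) (c : 'I_JB -> V) (r : 'I_JB -> R).
Variables (v : 'I_JH -> V) (rho : 'I_JH -> R).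
Hypotheses (hc : forall j, H (c j)) (hv : forall j, H (v j)).
Local Notation nrm := (ip_norm ip).
Local Notation cert := (certificate ip c r v rho).

(* When g0 is a Slater point, all the summands on the left are non-negative, hence
   bounded by the right-hand side. *)
Lemma certificate_slater (g0 h : V) (beta : R) (g : 'I_JB -> V) (xi : 'I_JH -> R) :
  H g0 -> H h -> (forall j, H (g j)) ->
  0 <= beta + \sum_j ip (g j) (c j) - \sum_j xi j * rho j
         - \sum_j r j * nrm (g j) ->
  - h + \sum_j g j - \sum_j xi j *: v j = 0 ->
  \sum_j (r j - nrm (g0 - c j)) * nrm (g j) +
    \sum_j xi j * (rho j - ip (v j) g0) <= beta + ip h g0.
Proof.
move=> hg0 hh hg h1 h2.
have msg : H (\sum_j g j) by exact: (mem_sum hH).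
have msv : H (\sum_j xi j *: v j) by apply: (mem_sum hH) => j _; exact: (memZ hH).
have -> : h = \sum_j g j - \sum_j xi j *: v j.
  by apply/eqP; rewrite eq_sym -subr_eq0 addrC addrA h2.
rewrite (ipBl hH)// !(ip_suml hH)//; last by move=> j _; exact: (memZ hH).
have hle j : ip (g j) (c j) - ip (g j) g0 <= nrm (g0 - c j) * nrm (g j).
  rewrite -(ipBr hH)// (nrmBC hH)// mulrC.
  by apply: (ip_le_nrm hH) => //; exact: (memB hH).
have : \sum_j (ip (g j) (c j) - ip (g j) g0) <= \sum_j nrm (g0 - c j) * nrm (g j).
  by apply: ler_sum => j _.
under [\sum_j (r j - _) * _]eq_bigr do rewrite mulrBl.
under [\sum_j xi j * (rho j - _)]eq_bigr do rewrite mulrBr.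
under [\sum_j ip (xi j *: v j) g0]eq_bigr do rewrite (ipZl hH)//.
rewrite !sumrB; lra.
Qed.

Lemma certificate_closed (g0 h : V) (beta : R) : H g0 -> H h ->
  (forall j, nrm (g0 - c j) < r j) -> (forall j, ip (v j) g0 < rho j) ->
  ~ cert h beta ->
  exists n (zs : 'I_n -> V) (eps : R), [/\ 0 < eps, forall k, H (zs k) &
    forall h' beta', H h' -> (forall k, `|ip (h' - h) (zs k)| < eps) ->
      `|beta' - beta| < eps -> ~ cert h' beta'].
Proof.
move=> hg0 hh sB sH ncert.
have hspan g : span_of h c v g -> H g by exact: (mem_span hH hc hv hh).
pose gens := h :: [seq c j | j <- enum 'I_JB] ++ [seq v j | j <- enum 'I_JH].
have sum0 m (w : 'I_m -> V) : \sum_l (0 : R) *: w l = 0.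
  by rewrite big1// => l _; rewrite scale0r.
have sum1 m (w : 'I_m -> V) j : \sum_l ((l == j)%:R : R) *: w l = w j.
  by rewrite (bigD1 j)//= eqxx scale1r big1 ?addr0// => l /negPf ->; rewrite scale0r.
have [|||n [e [eS eo es]]] := @gram_schmidt _ _ _ _ hH (span_of h c v) gens hspan.
- by exists 0, (fun=> 0), (fun=> 0); rewrite !sum0 scale0r !addr0.
- move=> t _ _ [a [al [be ->]]] [a' [al' [be' ->]]].
  exists (t * a + a'), (fun l => t * al l + al' l), (fun l => t * be l + be' l).
  under [\sum_l (t * al l + _) *: _]eq_bigr do rewrite scalerDl -scalerA.
  under [\sum_l (t * be l + _) *: _]eq_bigr do rewrite scalerDl -scalerA.
  rewrite !big_split /= -!scaler_sumr !scalerDr scalerDl scalerA.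
  by rewrite [LHS]addrACA [X in X + _ = _]addrACA.
- move=> w; rewrite inE mem_cat => /or3P[/eqP ->|/mapP[j _ ->]|/mapP[j _ ->]].
  + by exists 1, (fun=> 0), (fun=> 0); rewrite !sum0 scale1r !addr0.
  + by exists 0, (fun l => (l == j)%:R), (fun=> 0); rewrite sum0 sum1 scale0r add0r addr0.
  + by exists 0, (fun=> 0), (fun l => (l == j)%:R); rewrite sum0 sum1 scale0r !add0r.
have eH k : H (e k) by exact: hspan.
have Ph : h = oproj ip e h by apply: es; rewrite mem_head.
have Pc j : c j = oproj ip e (c j).
  by apply: es; rewrite inE mem_cat map_f ?orbT// mem_enum.
have Pv j : v j = oproj ip e (v j).
  by apply: es; rewrite inE mem_cat (map_f v) ?orbT// mem_enum.
(* The basis vectors will control the residual of the equation, and the strict point [g0] the size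
   of the multipliers. *)
pose zs (k : 'I_n.+1) := oapp e g0 (unlift ord0 k).
have zsH k : H (zs k) by rewrite /zs; case: (unlift _ _) => /=.
apply: contrapT => hno.
have {hno} near_cert (eps : R) : 0 < eps -> exists h' beta', [/\ H h',
    forall k, `|ip (h' - h) (zs k)| < eps, `|beta' - beta| < eps & cert h' beta'].
  move=> eps0; apply: contrapT => hno'; apply: hno.
  exists n.+1, zs, eps; split => // h' beta' mh' h1 h2 h3.
  by apply: hno'; exists h', beta'.
pose T : finType := ('I_JB * 'I_n + 'I_JH)%type.
(* Bounds the right-hand side of [certificate_slater] nearby: with eps at most 1, beta' and <h', g0>
   each grow by less than 1. *)
pose bd := beta + ip h g0 + 2.
pose A (t : T) : set R := match t with
  | inl p => `[- (bd / (r p.1 - nrm (g0 - c p.1))),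
               bd / (r p.1 - nrm (g0 - c p.1))]%classic
  | inr l => `[0, bd / (rho l - ip (v l) g0)]%classic end.
pose eqn (z : T -> R) k := - ip h (e k) + \sum_j z (inl (j, k))
   - \sum_l z (inr l) * ip (v l) (e k).
pose ine (z : T -> R) := beta + \sum_j \sum_k z (inl (j, k)) * ip (c j) (e k)
   - \sum_l z (inr l) * rho l
   - \sum_j r j * Num.sqrt (\sum_k z (inl (j, k)) * z (inl (j, k))).
(* Total violation: the second term is twice the negative part of the slack. In the box, where the
   xi are non-negative, a zero of [Psi] is a certificate for (h, beta). *)
pose Psi z := \sum_k `|eqn z k| + (`|ine z| - ine z).
have [| | |z hz hPsi] := @compact_box_le0 R T A Psi.
- by case=> t; exact: segment_compact.
- have cz t : continuous (fun z : 'rV[R]_#|T| => z 0 (enum_rank t)).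
    exact: coord_continuous.
  have cE : continuous (fun z : 'rV[R]_#|T| => ine (fun t => z 0 (enum_rank t))).
    move=> z; have FF := nbhs_filter z; have cz' t := cz t z.
    apply: cvgB; last first.
      apply: cvg_fsum => j; apply: cvg_cstM.
      apply: (@cvg_comp _ _ _ _ Num.sqrt _ _ _ _ (@sqrt_continuous R _)).
      by apply: cvg_fsum => k; apply: cvgM; exact: cz'.
    apply: cvgB; last by apply: cvg_fsum => j; apply: cvg_Mcst; exact: cz'.
    apply: cvg_cstD; apply: cvg_fsum => j; apply: cvg_fsum => k.
    by apply: cvg_Mcst; exact: cz'.
  move=> z; have FF := nbhs_filter z; have cz' t := cz t z.
  apply: cvgD.
    apply: cvg_fsum => k; apply: cvg_norm; apply: cvgB; last first.
      by apply: cvg_fsum => j; apply: cvg_Mcst; exact: cz'.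
    by apply: cvg_cstD; apply: cvg_fsum => j; exact: cz'.
  by apply: cvgB; [apply: cvg_norm; exact: cE|exact: cE].
- move=> del d0.
  (* Below, n residual coordinates contribute at most eps each and the slack at most 2 eps. *)
  pose eps : R := Num.min 1 (del / (n.+2)%:R).
  have eps0 : 0 < eps by rewrite lt_min ltr01 divr_gt0.
  have [h' [beta' [mh' hz hbeta [g [xi [hs hxi hval heq]]]]]] := near_cert _ eps0.
  have mg j : H (g j) by exact: (mem_span hH hc hv mh').
  have mx : H (\sum_j xi j *: v j) by apply: (mem_sum hH) => j _; exact: (memZ hH).
  have ms : H (\sum_j g j) by exact: (mem_sum hH).
  have hek k : `|ip (h' - h) (e k)| < eps.
    by have := hz (lift ord0 k); rewrite /zs liftK.
  have hg00 : `|ip (h' - h) g0| < eps.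
    by have := hz ord0; rewrite /zs unlift_none.
  have e1 : eps <= 1 by rewrite /eps ge_min lexx.
  have hb : \sum_j (r j - nrm (g0 - c j)) * nrm (g j) +
      \sum_j xi j * (rho j - ip (v j) g0) <= bd.
    apply: le_trans (certificate_slater hg0 mh' mg hval heq) _.
    move: hbeta hg00; rewrite (ipBl hH)// !ltr_norml /bd.
    by move=> /andP[_ ?] /andP[_ ?]; lra.
  have p1 j : 0 <= (r j - nrm (g0 - c j)) * nrm (g j).
    by rewrite mulr_ge0 ?nrm_ge0// subr_ge0 ltW.
  have p2 j : 0 <= xi j * (rho j - ip (v j) g0).
    by rewrite mulr_ge0// subr_ge0 ltW.
  have b1 j : nrm (g j) <= bd / (r j - nrm (g0 - c j)).
    rewrite ler_pdivlMr ?subr_gt0// mulrC; apply: le_trans hb.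
    rewrite (bigD1 j)//= -addrA lerDl addr_ge0//; exact: sumr_ge0.
  have b2 j : xi j <= bd / (rho j - ip (v j) g0).
    rewrite ler_pdivlMr ?subr_gt0//; apply: le_trans hb.
    rewrite [X in _ <= _ + X](bigD1 j)//= addrCA lerDl addr_ge0//; exact: sumr_ge0.
  pose z (t : T) := match t with inl p => ip (g p.1) (e p.2) | inr l => xi l end.
  exists z.
    case=> [[j k]|l] /=; rewrite in_itv /=; last by rewrite hxi b2.
    rewrite -ler_norml; apply: le_trans (cauchy_schwarz hH (mg j) (eH k)) _.
    have -> : nrm (e k) = 1 by rewrite /ip_norm eo eqxx sqrtr1.
    by rewrite mulr1.
  (* The equation is exact for h', so with h in its place the residual is [h' - h]. *)
  have hEq k : eqn z k = ip (h' - h) (e k).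
    have -> : h' = \sum_j g j - \sum_j xi j *: v j.
      by apply/eqP; rewrite eq_sym -subr_eq0 addrC addrA heq.
    rewrite (ipBl hH)//; last exact: (memB hH).
    rewrite (ipBl hH)// !(ip_suml hH)//; last by move=> j _; exact: (memZ hH).
    under [\sum_i ip (xi i *: v i) (e k)]eq_bigr do rewrite (ipZl hH)//.
    by rewrite /eqn /z /=; ring.
  (* Projection keeps the pairings with the c_j and shrinks norms, so only the difference between
     beta and beta' can make the slack negative. *)
  have hIne : - eps <= ine z.
    have hc' j : \sum_k ip (g j) (e k) * ip (c j) (e k) = ip (g j) (c j).
      rewrite -(ip_coords hH eH eo) -!/(oproj ip e _) -Pc.
      exact: (oproj_adj hH).
    have hn j : Num.sqrt (\sum_k ip (g j) (e k) * ip (g j) (e k)) <= nrm (g j).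
      rewrite -(ip_coords hH eH eo) -!/(oproj ip e _).
      exact: (oproj_nrm hH).
    have hn' : \sum_j r j * Num.sqrt (\sum_k ip (g j) (e k) * ip (g j) (e k)) <=
        \sum_j r j * nrm (g j).
      apply: ler_sum => j _; apply: ler_wpM2l => //.
      by apply: le_trans (ltW (sB j)); exact: nrm_ge0.
    rewrite /ine /z /=; under eq_bigr do rewrite hc'.
    by move: hbeta; rewrite ltr_norml => /andP[? ?]; lra.
  have hI2 : `|ine z| - ine z <= eps *+ 2.
    rewrite mulr2n; have [h0|h0] := leP 0 (ine z).
      by rewrite ger0_norm//; lra.
    by rewrite ltr0_norm//; lra.
  have hE2 : \sum_k `|eqn z k| <= eps *+ n.
    rewrite -[n in _ *+ n]card_ord -sumr_const; apply: ler_sum => k _.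
    by rewrite hEq ltW.
  apply: le_trans (lerD hE2 hI2) _; rewrite -mulrnDr addn2 -mulr_natr.
  rewrite -ler_pdivlMr//; first by rewrite /eps ge_min lexx orbT.
have hI : 0 <= `|ine z| - ine z by rewrite subr_ge0 ler_norm.
have hE : 0 <= \sum_k `|eqn z k| by exact: sumr_ge0.
have hI0 : `|ine z| - ine z = 0 by move: hPsi; rewrite /Psi; lra.
have hE0 : \sum_k `|eqn z k| = 0 by move: hPsi; rewrite /Psi; lra.
have {hI0} hine : 0 <= ine z.
  by move/eqP: hI0; rewrite subr_eq0 => /eqP <-.
have {hE0} heqn k : eqn z k = 0.
  move: hE0 => /eqP; rewrite psumr_eq0// => /allP/(_ k (mem_index_enum _)).
  by rewrite normr_eq0 => /eqP.
apply: ncert.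
pose g j := \sum_k z (inl (j, k)) *: e k.
have mg j : H (g j) by apply: (mem_sum hH) => k _; exact: (memZ hH).
have ms : H (\sum_j g j) by exact: (mem_sum hH).
have mx : H (\sum_j z (inr j) *: v j) by apply: (mem_sum hH) => j _; exact: (memZ hH).
exists g, (fun l => z (inr l)); split.
- move=> j; have Slin w w' :
      span_of h c v w -> span_of h c v w' -> span_of h c v (w + w').
    move=> [a [al [be ->]]] [a' [al' [be' ->]]].
    exists (a + a'), (fun l => al l + al' l), (fun l => be l + be' l).
    under [\sum_l (al l + _) *: _]eq_bigr do rewrite scalerDl.
    under [\sum_l (be l + _) *: _]eq_bigr do rewrite scalerDl.
    by rewrite !big_split scalerDl [LHS]addrACA [X in X + _ = _]addrACA.
  apply: (big_ind (span_of h c v)) => //.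
    by exists 0, (fun=> 0), (fun=> 0); rewrite !sum0 scale0r !addr0.
  move=> k _; have [a [al [be ->]]] := eS k; move: (z _) => t.
  exists (t * a), (fun l => t * al l), (fun l => t * be l).
  by rewrite !scalerDr scalerA !scaler_sumr; congr (_ + _ + _);
     apply: eq_bigr => l _; rewrite scalerA.
- by move=> j; have := hz (inr j); rewrite /= in_itv /= => /andP[].
- have hgc j : \sum_k z (inl (j, k)) * ip (c j) (e k) = ip (g j) (c j).
    by rewrite -(ip_coords hH eH eo) -!/(oproj ip e _) -Pc.
  have hgn j : Num.sqrt (\sum_k z (inl (j, k)) * z (inl (j, k))) = nrm (g j).
    by rewrite -(ip_coords hH eH eo).
  apply: le_trans hine _; rewrite /ine.
  by under eq_bigr do rewrite hgc; under [X in _ - X]eq_bigr do rewrite hgn.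
- have sgE : \sum_j g j = \sum_k (\sum_j z (inl (j, k))) *: e k.
    rewrite /g exchange_big; apply: eq_bigr => k _; by rewrite scaler_suml.
  have svE : \sum_l z (inr l) *: v l = \sum_k (\sum_l z (inr l) * ip (v l) (e k)) *: e k.
    under [RHS]eq_bigr do rewrite scaler_suml.
    rewrite exchange_big; apply: eq_bigr => l _; rewrite {1}Pv scaler_sumr.
    by apply: eq_bigr => k _; rewrite scalerA.
  rewrite sgE svE {1}Ph /oproj -sumrN -big_split -sumrB big1// => k _ /=.
  by rewrite -scaleNr -scalerDl -scalerBl -/(eqn z k) heqn scale0r.
Qed.

End CertificateClosed.

Section WeakNbhs.
Variables (R : realType) (V : lmodType R) (H : set V) (ip : V -> V -> R).

(** Weak neighbourhoods as a filter, so that the calculus of limits applies to [weakly_closed],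
    which asks that the complement belong to this filter. *)
Definition wnbhs (x : V) : set_system V := [set A | exists n
  (phi : 'I_n -> V -> R) (e : R), [/\ 0 < e, forall k, is_dual H ip (phi k) &
    forall y, H y -> (forall k, `|phi k y - phi k x| < e) -> A y]].

Global Instance wnbhs_filter x : Filter (wnbhs x).
Proof.
split.
- by exists 0%N, (fun=> cst 0), 1; split => // -[].
- move=> A A' [n [phi [e [e0 hphi hA]]]] [n' [phi' [e' [e0' hphi' hA']]]].
  exists (n + n')%N, (fun k : 'I_(n + n') => match fintype.split k with
    | inl i => phi i | inr i => phi' i end), (Num.min e e'); split.
  + by rewrite lt_min e0.
  + by move=> k; case: (fintype.split k).
  + move=> y Hy hy; split; [apply: hA => // k|apply: hA' => // k].
      have := hy (lshift n' k); rewrite (unsplitK (inl k)) => /lt_le_trans; apply.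
      by rewrite ge_min lexx.
    have := hy (rshift n k); rewrite (unsplitK (inr k)) => /lt_le_trans; apply.
    by rewrite ge_min lexx orbT.
- move=> A A' AA' [n [phi [e [e0 hphi hA]]]]; exists n, phi, e; split => // y Hy hy.
  exact/AA'/hA.
Qed.

Lemma wnbhs_dom x : \forall y \near wnbhs x, H y.
Proof. by exists 0%N, (fun=> cst 0), 1; split => // -[]. Qed.

Lemma dual_cvg (phi : V -> R) x :
  is_dual H ip phi -> phi y @[y --> wnbhs x] --> phi x.
Proof.
move=> hphi; apply/cvgrPdist_lt => e e0.
exists 1%N, (fun=> phi), e; split => // y _ /(_ ord0).
by rewrite distrC.
Qed.

Lemma weakly_closedI (A : set V) : A `<=` H ->
  (forall x, H x -> ~ A x -> \forall y \near wnbhs x, ~ A y) ->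
  weakly_closed H ip A.
Proof. by move=> AH hA; split. Qed.

End WeakNbhs.

Section ProductWeakNbhs.
Variables (R : realType) (V : lmodType R) (H : set V) (ip : V -> V -> R) (B : nat).
Hypothesis hH : prehilbert H ip.
Let H2 : set (V * 'cV[R]_B) := H `*` [set: 'cV[R]_B].
Let ip2 : V * 'cV[R]_B -> V * 'cV[R]_B -> R := ip_prod ip (n := B).

Lemma nrm_prod1 (x : V * 'cV[R]_B) : H x.1 -> ip_norm ip x.1 <= ip_norm ip2 x.
Proof.
by move=> hx; rewrite ler_wsqrtr// lerDl (ip_ge0 (@dotv_pre R B)).
Qed.

Lemma nrm_prod2 (x : V * 'cV[R]_B) k : H x.1 -> `|x.2 k 0| <= ip_norm ip2 x.
Proof.
move=> hx; rewrite -sqrtr_sqr ler_wsqrtr// /ip2 /ip_prod.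
rewrite ler_wpDl ?(ip_ge0 hH)// /dotv (bigD1 k)//= expr2 lerDl.
by apply: sumr_ge0 => i _; rewrite -expr2 sqr_ge0.
Qed.

Lemma wcvg_ip z (x : V * 'cV[R]_B) : H z -> ip y.1 z @[y --> wnbhs H2 ip2 x] --> ip x.1 z.
Proof.
move=> hz; apply: (dual_cvg (phi := fun y => ip y.1 z)); split.
  by move=> a [y y'] [t t'] [/= hy _] [/= ht _]; rewrite (pre_linl hH).
exists (ip_norm ip z) => -[y y'] [/= hy _].
apply: le_trans (cauchy_schwarz hH hy hz) _; rewrite mulrC ler_wpM2l ?nrm_ge0//.
exact: (nrm_prod1 (x := (y, y'))).
Qed.

Lemma wcvg_coord (k : 'I_B) (x : V * 'cV[R]_B) :
  (fun y : V * 'cV[R]_B => y.2 k 0) @ wnbhs H2 ip2 x --> x.2 k 0.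
Proof.
apply: (dual_cvg (phi := fun y : V * 'cV[R]_B => y.2 k 0)); split.
  by move=> a [y y'] [t t'] _ _ /=; rewrite !mxE.
exists 1 => -[y y'] [/= hy _]; rewrite mul1r.
exact: (nrm_prod2 (x := (y, y'))).
Qed.

Lemma wnbhs_dom1 x : \forall y \near wnbhs H2 ip2 x, H y.1.
Proof. by apply: filterS (wnbhs_dom H2 ip2 x) => y []. Qed.

(** Pairing with the fixed vector [x.1 - f0] is weakly continuous, and by Cauchy-Schwarz it bounds
    the norm of [y.1 - f0] from below. *)
Lemma nrm_wlsc f0 (x : V * 'cV[R]_B) (a : R) : H f0 -> H x.1 -> 0 <= a ->
  a < ip_norm ip (x.1 - f0) ->
  \forall y \near wnbhs H2 ip2 x, a < ip_norm ip (y.1 - f0).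
Proof.
move=> hf0 hx a0 hax; have mx := memB hH hx hf0.
have n0 : 0 < ip_norm ip (x.1 - f0) by exact: le_lt_trans hax.
have c1 : ip y.1 (x.1 - f0) - ip f0 (x.1 - f0) @[y --> wnbhs H2 ip2 x] -->
    ip x.1 (x.1 - f0) - ip f0 (x.1 - f0).
  by apply: cvgB; [exact: wcvg_ip|exact: cvg_cst].
have c2 : a * ip_norm ip (x.1 - f0) < ip x.1 (x.1 - f0) - ip f0 (x.1 - f0).
  by rewrite -(ipBl hH)// -(nrm_sqr hH)// expr2 ltr_pM2r.
apply: filterS2 (wnbhs_dom1 x) (cvgr_gt _ c1 _ c2) => y hy.
rewrite -(ipBl hH)// => hlt; rewrite -(ltr_pM2r n0); apply: lt_le_trans hlt _.
by apply: (ip_le_nrm hH) => //; exact: (memB hH).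
Qed.

End ProductWeakNbhs.

(** * Weak closedness of the constraint sets and weak lower semicontinuity of the loss *)

Section WeakClosedness.
Variables (R : realType) (d Q B s : nat) (X : set 'rV[R]_d).
Hypothesis hX : X `<=` closure X°.
Variables (nu : 'rV[R]_d -> R) (K : mvkern R d Q).
Hypotheses (hnu : is_norm nu) (hK : is_mvkernel X K) (hKs : smooth_kernel X s K).
Variables (F : set (vfun R d Q)) (ip : vfun R d Q -> vfun R d Q -> R).
Hypothesis hF : is_rkhs X K F ip.
Let hilb := rkhs_hilbert hF.
Let hH := hilbert_pre hilb.
Local Notation nrm := (ip_norm ip).
Local Notation wnb := (wnbhs (F `*` [set: 'cV[R]_B]) (ip_prod ip (n := B))).

Lemma wcvg_op_at (D : diffop R d Q s) x fb : X x -> F fb.1 ->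
  op_at X D y.1 x @[y --> wnb fb] --> op_at X D fb.1 x.
Proof.
move=> Xx hf; have [hm hr] := opK_reproducing hX hK hKs hF D Xx.
rewrite hr//; apply: cvg_trans (wcvg_ip hH hm); apply: near_eq_cvg.
by apply: filterS (wnbhs_dom1 F ip fb) => y hy; rewrite -hr.
Qed.

(** For finite eta, a failing inequality has a witness u; at fixed u the quadratic form is weakly
    continuous and eta ||f - f0|| |u|^2 is weakly l.s.c., so the strict violation persists. *)
Lemma C_soc_wclosed P M (D : 'I_P -> 'I_P -> diffop R d Q s) f0
    (b0 : 'cV[R]_P) (Gam : 'M[R]_(P, B)) (xt : 'I_M -> 'rV[R]_d) del fb :
  (forall f x, F f -> X x -> (opmx X D f x)^T = opmx X D f x) ->
  (0 < P)%N -> (forall m, X (xt m)) -> (forall m, 0 < del m) ->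
  F f0 -> F fb.1 -> ~ C_soc X nu K F ip D f0 b0 Gam xt del fb ->
  \forall y \near wnb fb, ~ C_soc X nu K F ip D f0 b0 Gam xt del y.
Proof.
move=> hD P0 hxt hdel hf0 hf nC.
have FW : Filter (nbhs (wnb fb)) := wnbhs_filter _ _ fb.
have hDv := @dotv_pre R P.
pose A m (y : vfun R d Q * 'cV[R]_B) :=
  opmx X D (y.1 - f0) (xt m) + diag_mx (Gam *m y.2 - b0)^T.
pose q m u y := dotv u (A m y *m u).
have hq m u : q m u y @[y --> wnb fb] --> q m u fb.
  rewrite /q /dotv; apply: cvg_fsum => i; apply: cvg_cstM.
  have e1 y : F y.1 -> (A m y *m u) i 0 = \sum_j ((op_at X (D i j) y.1 (xt m)
     - op_at X (D i j) f0 (xt m)) +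
     ((\sum_k Gam i k * y.2 k 0) - b0 i 0) * (i == j)%:R) * u j 0.
    move=> hy; rewrite mxE; apply: eq_bigr => j _; congr (_ * _).
    rewrite /A !mxE (op_atB hX hK hKs hF)//; congr (_ + _).
    by rewrite mulr_natr; case: eqP => // ->.
  rewrite e1//; apply: cvg_trans; first apply: near_eq_cvg.
    by apply: filterS (wnbhs_dom1 F ip fb) => y hy; rewrite e1.
  apply: cvg_fsum => j; apply: cvg_Mcst; apply: cvgD.
    by apply: cvgB; [exact: wcvg_op_at|exact: cvg_cst].
  apply: cvg_Mcst; apply: cvgB; last exact: cvg_cst.
  by apply: cvg_fsum => k; apply: cvg_cstM; exact: wcvg_coord.
(* Symmetry always holds, so [loewner_le] can fail only through the quadratic form. *)
have symA m y : F y.1 -> (A m y)^T = A m y.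
  move=> hy; rewrite /A linearD /= hD//; last exact: (memB hH).
  by rewrite tr_diag_mx.
have sym_sub m y (e : R) : F y.1 -> (A m y - e%:M)^T = A m y - e%:M.
  by move=> hy; rewrite linearB /= symA// tr_scalar_mx.
have quad m y (e : R) u : dotv u ((A m y - e%:M) *m u) = q m u y - e * dotv u u.
  by rewrite mulmxBl (ipBr hDv)// mul_scalar_mx (ipZr hDv).
have [m hm] : exists m, ~ exists2 e : R,
    (eta_soc X nu K ip D (xt m) (del m) * (nrm (fb.1 - f0))%:E = e%:E)%E &
    loewner_le e%:M (A m fb).
  apply: contrapT => hno; apply: nC; split => // m.
  by apply: contrapT => hm; apply: hno; exists m.
have eta0 := eta_soc_ge0 K hnu ip D P0 (hxt m) (hdel m).
have uu0 (u : 'cV[R]_P) : 0 <= dotv u u by rewrite (ip_ge0 hDv).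
suff : \forall y \near wnb fb, ~ exists2 e : R,
    (eta_soc X nu K ip D (xt m) (del m) * (nrm (y.1 - f0))%:E = e%:E)%E &
    loewner_le e%:M (A m y).
  by move=> hw; apply: filterS hw => y hy [_ /(_ m)].
move: hm eta0; case: (eta_soc _ _ _ _ _ _ _) => [h|/=|//] hm.
  rewrite lee_fin => h0.
  have [u hu] : exists u, q m u fb < h * nrm (fb.1 - f0) * dotv u u.
    apply: contrapT => hno; apply: hm; exists (h * nrm (fb.1 - f0)) => //.
    split; first exact: sym_sub.
    move=> u; rewrite quad subr_ge0 leNgt; apply/negP => hlt.
    by apply: hno; exists u.
  have : \forall y \near wnb fb, q m u y < h * nrm (y.1 - f0) * dotv u u.
    set t := h * dotv u u; have t0 : 0 <= t by exact: mulr_ge0.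
    have {}hu : q m u fb < t * nrm (fb.1 - f0) by rewrite /t mulrAC.
    suff hs : \forall y \near wnb fb, q m u y < t * nrm (y.1 - f0).
      by apply: filterS hs => y; rewrite /t mulrAC.
    (* [nrm_wlsc] needs a non-negative threshold: a negative value of the form is settled by sign,
       and otherwise t > 0 and a midpoint separates the two sides. *)
    have [qn|qp] := ltP (q m u fb) 0.
      apply: filterS (cvgr_lt _ (hq m u) _ qn) => y /lt_le_trans; apply.
      by rewrite mulr_ge0// nrm_ge0.
    have tp : 0 < t.
      rewrite lt_neqAle t0 andbT; apply: contraTneq hu => <-.
      by rewrite mul0r -leNgt.
    pose mid := (q m u fb + t * nrm (fb.1 - f0)) / 2.
    have mid1 : q m u fb < mid by rewrite /mid; lra.
    have mid2 : mid / t < nrm (fb.1 - f0).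
      by rewrite ltr_pdivrMr// mulrC /mid; lra.
    have mid0 : 0 <= mid / t by rewrite divr_ge0//; exact: le_trans (ltW mid1).
    apply: filterS2 (cvgr_lt _ (hq m u) _ mid1) (nrm_wlsc hH hf0 hf mid0 mid2).
    move=> y hy; rewrite ltr_pdivrMr// mulrC; exact: lt_trans.
  move=> hw; apply: filterS hw => y hy [e [<-] [_ /(_ u)]].
  by rewrite quad subr_ge0 leNgt hy.
(* Here eta is +oo. If the norm is 0, so is the product, and the form is negative at some u; this
   persists since the product is never negative. If the norm is positive, it stays so nearby and the
   product is infinite. *)
move=> _; have [n0|n0] := eqVneq (nrm (fb.1 - f0)) 0.
  have [u hu] : exists u, q m u fb < 0.
    apply: contrapT => hno; apply: hm; exists 0; first by rewrite n0 mule0.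
    split; first exact: sym_sub.
    move=> u; rewrite quad mul0r subr0 leNgt; apply/negP => hlt.
    by apply: hno; exists u.
  apply: filterS (cvgr_lt _ (hq m u) _ hu) => y hy [e he [_ /(_ u)]].
  rewrite quad subr_ge0 leNgt => /negP; apply; apply: lt_le_trans hy _.
  by rewrite mulr_ge0// -lee_fin -he mule_ge0// lee_fin nrm_ge0.
have np : 0 < nrm (fb.1 - f0) by rewrite lt_neqAle eq_sym n0 nrm_ge0.
apply: filterS (nrm_wlsc hH hf0 hf (lexx 0) np) => y hy [e].
by rewrite mulyr gtr0_sg// mul1e.
Qed.

Lemma C_omega_wclosed M (JB JH : 'I_M -> nat) f0 b0 (Gam : 'rV[R]_B)
    (c : forall m, 'I_(JB m) -> vfun R d Q) (r : forall m, 'I_(JB m) -> R)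
    (v : forall m, 'I_(JH m) -> vfun R d Q) (rho : forall m, 'I_(JH m) -> R) fb :
  F f0 -> (forall m j, F (c m j)) -> (forall m j, F (v m j)) ->
  (forall m, Omega_set F ip (@c m) (@r m) (@v m) (@rho m) !=set0) ->
  F fb.1 -> ~ C_omega F ip f0 b0 Gam c r v rho fb ->
  \forall y \near wnb fb, ~ C_omega F ip f0 b0 Gam c r v rho y.
Proof.
move=> hf0 hc hv hOm hf nC.
have FW : Filter (nbhs (wnb fb)) := wnbhs_filter _ _ fb.
pose beta (y : vfun R d Q * 'cV[R]_B) := - b0 + (Gam *m y.2) 0 0.
have [m hm] : exists m,
    ~ certificate ip (@c m) (@r m) (@v m) (@rho m) (fb.1 - f0) (beta fb).
  apply: contrapT => hno; apply: nC; split => // m.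
  by apply: contrapT => hm; apply: hno; exists m.
(* Omega is cut out by strict inequalities, so any of its points is a Slater point. *)
have [g0 [hg0 sB sH]] := hOm m.
have mf := memB hH hf hf0.
have [n [zs [eps [eps0 hzs hcl]]]] :=
  certificate_closed hH (hc m) (hv m) hg0 mf sB sH hm.
have h1 k : \forall y \near wnb fb, `|ip (y.1 - fb.1) (zs k)| < eps.
  have /cvgrPdist_lt/(_ _ eps0) := wcvg_ip hH (x := fb) (hzs k).
  apply: filterS2 (wnbhs_dom1 F ip fb) => y hy.
  by rewrite (ipBl hH)// distrC.
have h2 : \forall y \near wnb fb, `|beta y - beta fb| < eps.
  have cb : beta y @[y --> wnb fb] --> beta fb.
    rewrite /beta; apply: cvg_cstD; rewrite mxE.
    under eq_cvg do rewrite mxE.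
    by apply: cvg_fsum => k; apply: cvg_cstM; exact: wcvg_coord.
  move/cvgrPdist_lt: cb => /(_ _ eps0); move=> hw.
  by apply: filterS hw => y; rewrite distrC.
have h3 : \forall y \near wnb fb, forall k, `|ip (y.1 - fb.1) (zs k)| < eps.
  exact: filter_forall h1.
have h4 := @filterI _ _ FW _ _ h3 h2.
have h5 : \forall y \near wnb fb, F y.1 by exact: wnbhs_dom1.
have h6 := @filterI _ _ FW _ _ h5 h4.
apply: (@filterS _ _ FW _ _ _ h6) => y [hy [k1 k2]] [_ /(_ m)].
apply: hcl => //; first exact: (memB hH).
by move=> k; rewrite opprB addrA subrK; exact: k1.
Qed.

(** The samples and b are finitely many weakly continuous functionals, so [L] keeps its lower
    semicontinuity; the norm is only weakly l.s.c., which suffices as [Reg] is non-decreasing. *)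
Lemma loss_S_wlsc N (J : 'I_N -> nat) (x : 'I_N -> 'rV[R]_d)
    (D0 : forall n, 'I_(J n) -> diffop R d Q s)
    (L : 'cV[R]_B -> 'rV[R]_(\sum_n J n) -> \bar R) (Reg : R -> R) fb (gam : R) :
  (forall n, X (x n)) -> (forall b y, L b y <> -oo%E) ->
  (forall z w : R, 0 <= z -> z <= w -> Reg z <= Reg w) ->
  lower_semicontinuous
     (fun by_ : 'cV[R]_B * 'rV[R]_(\sum_n J n) => L by_.1 by_.2) ->
  (forall z a : R, 0 <= z -> a < Reg z ->
      \forall w \near z, 0 <= w -> a < Reg w) ->
  F fb.1 -> (gam%:E < loss_S X D0 x ip L Reg fb)%E ->
  \forall y \near wnb fb, (gam%:E < loss_S X D0 x ip L Reg y)%E.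
Proof.
move=> hx hL hReg lscL lscR hf; rewrite /loss_S => hlt.
have FW : Filter (nbhs (wnb fb)) := wnbhs_filter _ _ fb.
set y0 := sample_values X D0 x fb.1 in hlt.
have [a [a' [ha ha' haa]]] : exists a a' : R, [/\ (a%:E < L fb.2 y0)%E,
    a' < Reg (nrm fb.1) & gam <= a + a'].
  move: hlt (hL fb.2 y0); case: (L fb.2 y0) => [l|_ _|_ /(_ erefl)//].
    rewrite -EFinD lte_fin => hlt _; set R0 := Reg _ in hlt *.
    (* The excess over [gam] is split evenly between the two terms. *)
    exists (l - (l + R0 - gam) / 2), (R0 - (l + R0 - gam) / 2).
    by rewrite lte_fin; split; lra.
  exists (gam - (Reg (nrm fb.1) - 1)), (Reg (nrm fb.1) - 1).
  by rewrite ltry; split => //; lra.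
have nearL : \forall y \near wnb fb,
    (a%:E < L y.2 (sample_values X D0 x y.1))%E.
  have [W [[A1 A2] /= [[P1 hP1 sP1] [P2 hP2 sP2]] hA] hW] := lscL (fb.2, y0) a ha.
  have n1 : \forall y \near wnb fb, forall p : 'I_B * 'I_1, 
      P1 p.1 p.2 ((y.2 : 'cV[R]_B) p.1 p.2).
    apply: filter_forall => -[i j] /=; rewrite (ord1 j).
    exact: (wcvg_coord hH (hP1 i 0)).
  have n2 : \forall y \near wnb fb, forall p : 'I_1 * 'I_(\sum_n J n),
      P2 p.1 p.2 (sample_values X D0 x y.1 p.1 p.2).
    apply: filter_forall => -[i j] /=; have := hP2 i j.
    rewrite /y0 !mxE => hj.
    have hw := wcvg_op_at (D := D0 _ (tagnat.sig2 j)) (hx (tagnat.sig1 j)) hf hj.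
    by apply: (@filterS _ _ FW _ _ _ hw) => y; rewrite !mxE.
  apply: (@filterS2 _ _ FW _ _ _ _ n1 n2) => y h1 h2.
  apply: (hW (y.2, _)); apply: hA; split => /=.
    by apply: sP1 => i j; exact: (h1 (i, j)).
  by apply: sP2 => i j; exact: (h2 (i, j)).
have nearR : \forall y \near wnb fb, a' < Reg (nrm y.1).
  (* At norm 0 [Reg] is minimal. Otherwise lower semicontinuity passes the bound on to a slightly
     smaller [w], which the norm exceeds nearby. *)
  have [n0|n0] := eqVneq (nrm fb.1) 0.
    apply: filterS (wnbhs_dom1 F ip fb) => y hy; apply: lt_le_trans ha' _.
    by rewrite n0; apply: hReg => //; exact: nrm_ge0.
  have np : 0 < nrm fb.1 by rewrite lt_neqAle eq_sym n0 nrm_ge0.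
  have [del /= d0 hdel] := lscR _ _ (ltW np) ha'.
  pose w := Num.max 0 (nrm fb.1 - del / 2).
  have w0 : 0 <= w by rewrite le_max lexx.
  have wn : w < nrm fb.1 by rewrite gt_max np /=; lra.
  have hw : a' < Reg w.
    apply: hdel => //=; rewrite ger0_norm ?subr_ge0 ?(ltW wn)//.
    rewrite ltrBlDr -ltrBlDl; apply: (@lt_le_trans _ _ (nrm fb.1 - del / 2)).
      by lra.
    by rewrite le_max lexx orbT.
  have h0 := pre0 hH.
  have wn' : w < nrm (fb.1 - 0) by rewrite subr0.
  apply: filterS (nrm_wlsc hH h0 hf w0 wn') => y; rewrite subr0 => hy.
  by apply: lt_le_trans hw _; apply: hReg => //; exact: ltW.
apply: (@filterS2 _ _ FW _ _ _ _ nearL nearR) => y h1 h2.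
apply: (@le_lt_trans _ _ (a%:E + a'%:E)%E); first by rewrite -EFinD lee_fin.
by rewrite lteD// lte_fin.
Qed.

End WeakClosedness.

(** * Coercivity and weak lower semicontinuity of the constrained objective *)

Section Existence.
Variables (R : realType) (d Q B s : nat) (X : set 'rV[R]_d).
Hypothesis hX : X `<=` closure X°.
Variable K : mvkern R d Q.
Hypotheses (hK : is_mvkernel X K) (hKs : smooth_kernel X s K).
Variables (F : set (vfun R d Q)) (ip : vfun R d Q -> vfun R d Q -> R).
Hypothesis hF : is_rkhs X K F ip.
Let hilb := rkhs_hilbert hF.
Let hH := hilbert_pre hilb.
Local Notation nrm := (ip_norm ip).
Variables (N : nat) (J : 'I_N -> nat) (x : 'I_N -> 'rV[R]_d).
Hypothesis hx : forall n, X (x n).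
Variable D0 : forall n, 'I_(J n) -> diffop R d Q s.
Variable L : 'cV[R]_B -> 'rV[R]_(\sum_n J n) -> \bar R.
Hypothesis hL : forall b y, L b y <> -oo%E.
Variable Reg : R -> R.
Hypothesis hReg : forall z w : R, 0 <= z -> z <= w -> Reg z <= Reg w.
Variable C : set (vfun R d Q * 'cV[R]_B).
Local Notation LS := (loss_S X D0 x ip L Reg).

Lemma loss_S_char_le fb (gam : R) :
  (LS fb + char_fun R C fb <= gam%:E)%E -> C fb /\ (LS fb <= gam%:E)%E.
Proof.
rewrite /char_fun; case: ifPn => [/set_mem hc|_]; first by rewrite adde0.
rewrite /loss_S; move: (@hL fb.2 (sample_values X D0 x fb.1)).
by case: (L _ _) => [l|_|/(_ erefl)//]; rewrite ?leye_eq.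
Qed.

Lemma sample_values_bounded (M : R) : exists rad : R, 0 < rad /\
  forall f, F f -> nrm f <= M -> l2norm (sample_values X D0 x f) <= rad.
Proof.
pose C0 (k : 'I_(\sum_n J n)) :=
  M * nrm (opK X (D0 (tagnat.sig2 k)) K (x (tagnat.sig1 k))).
exists (Num.sqrt (\sum_(i < 1) \sum_k C0 k ^+ 2) + 1); split.
  by rewrite ltr_wpDl// sqrtr_ge0.
move=> f hf hM; apply: (@le_trans _ _ (Num.sqrt (\sum_(i < 1) \sum_k C0 k ^+ 2))).
  apply: ler_wsqrtr; apply: ler_sum => i _; apply: ler_sum => k _; rewrite !mxE.
  have [hm hr] := opK_reproducing hX hK hKs hF (D0 (tagnat.sig2 k)) (hx (tagnat.sig1 k)).
  rewrite hr// -[leLHS]real_normK ?num_real//.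
  have h1 : `|ip f (opK X (D0 (tagnat.sig2 k)) K (x (tagnat.sig1 k)))| <= C0 k.
    apply: le_trans (cauchy_schwarz hH hf hm) _.
    by rewrite ler_wpM2r ?nrm_ge0.
  by rewrite lerXn2r ?nnegrE ?normr_ge0//; exact: le_trans (normr_ge0 _) h1.
by rewrite lerDl.
Qed.

(** The lower bound on [L] turns a bound on the loss into one on [Reg], hence on the norm of f; the
    samples then lie in a fixed ball, over which [L] is uniformly coercive in b. *)
Lemma loss_S_coercive :
  Reg z @[z --> +oo] --> +oo ->
  (forall rad : R, 0 < rad -> forall A : R, exists t : R,
     forall b : 'cV[R]_B, t <= l2norm b ->
     (A%:E <= ereal_inf [set L b y | y in [set y | (l2norm y <= rad)%R]])%E) ->
  (exists l : R, forall fb, C fb ->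
     (l%:E <= L fb.2 (sample_values X D0 x fb.1))%E) ->
  coercive (F `*` [set: 'cV[R]_B]) (ip_prod ip (n := B))
    (fun fb => LS fb + char_fun R C fb)%E.
Proof.
move=> cReg cL [l hl] gam.
move/cvgryPgt/(_ (gam - l)) : cReg => -[M [_ hM]].
have [rad [rad0 hrad]] := sample_values_bounded M.
(* As [Reg] is at least [Reg 0], a value of [L] this large would make the loss at least gam + 1. *)
have [t ht] := cL _ rad0 (gam - Reg 0 + 1).
exists (M + t) => fb [hf _] /loss_S_char_le[hc]; rewrite /loss_S.
set y := sample_values X D0 x fb.1 => hLS.
have hly : (l%:E <= L fb.2 y)%E by exact: hl.
have nM : nrm fb.1 <= M.
  rewrite leNgt; apply/negP => /hM hlt.
  have : ((l + Reg (nrm fb.1))%:E <= gam%:E)%E.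
    by apply: le_trans hLS; rewrite EFinD leeD2r.
  by rewrite lee_fin => h; move: hlt; rewrite /=; lra.
have hb : l2norm fb.2 < t.
  rewrite ltNge; apply/negP => /ht hA.
  have h1 : ((gam - Reg 0 + 1)%:E <= L fb.2 y)%E.
    apply: le_trans hA _; apply: ereal_inf_lbound; exists y => //=.
    exact: hrad.
  have : ((gam - Reg 0 + 1 + Reg (nrm fb.1))%:E <= gam%:E)%E.
    by apply: le_trans hLS; rewrite EFinD leeD2r.
  have := hReg (lexx 0) (nrm_ge0 ip fb.1).
  by rewrite lee_fin; lra.
have eb : l2norm fb.2 ^+ 2 = dotv fb.2 fb.2.
  rewrite sqr_sqrtr; last first.
    by apply: sumr_ge0 => i _; apply: sumr_ge0 => j _; exact: sqr_ge0.
  by apply: eq_bigr => i _; rewrite big_ord1 expr2.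
have b0 : 0 <= l2norm fb.2 by exact: sqrtr_ge0.
have f0 := nrm_ge0 ip fb.1.
apply: (@le_trans _ _ (nrm fb.1 + l2norm fb.2)); last by lra.
rewrite /ip_norm /ip_prod -/(nrm fb.1) -eb -(nrm_sqr hH hf).
rewrite -[leRHS]ger0_norm ?addr_ge0// -sqrtr_sqr; apply: ler_wsqrtr.
by rewrite sqrrD; nra.
Qed.

Lemma loss_S_weakly_lsc :
  (forall fb, F fb.1 -> ~ C fb ->
    \forall y \near wnbhs (F `*` [set: 'cV[R]_B]) (ip_prod ip (n := B)) fb, ~ C y) ->
  lower_semicontinuous
    (fun by_ : 'cV[R]_B * 'rV[R]_(\sum_n J n) => L by_.1 by_.2) ->
  (forall z a : R, 0 <= z -> a < Reg z ->
     \forall w \near z, 0 <= w -> a < Reg w) ->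
  weakly_lsc (F `*` [set: 'cV[R]_B]) (ip_prod ip (n := B))
    (fun fb => LS fb + char_fun R C fb)%E.
Proof.
move=> hCw lscL lscR gam; apply: weakly_closedI; first by move=> fb [].
move=> fb [hf hf'] nA.
have FW : Filter (nbhs (wnbhs (F `*` [set: 'cV[R]_B]) (ip_prod ip (n := B)) fb)).
  exact: wnbhs_filter.
have [hc|hc] := pselect (C fb); last first.
  have hn := hCw fb hf hc.
  by apply: (@filterS _ _ FW _ _ _ hn) => y nC [_ /loss_S_char_le[]].
have hlt : (gam%:E < LS fb)%E.
  rewrite ltNge; apply/negP => hle; apply: nA; split => //.
  by rewrite /char_fun mem_set// adde0.
have hn := loss_S_wlsc hX hK hKs hF hx hL hReg lscL lscR hf hlt.
apply: (@filterS _ _ FW _ _ _ hn) => y hy [_ /loss_S_char_le[_]].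
by rewrite leNgt hy.
Qed.

End Existence.

Theorem proposition8 (R : realType) (d Q B s : nat)
  (X : set 'rV[R]_d) (hX : X `<=` closure X°)
  (nu : 'rV[R]_d -> R) (hnu : is_norm nu)
  (K : mvkern R d Q) (hK : is_mvkernel X K) (hKs : smooth_kernel X s K)
  (F : set (vfun R d Q)) (ip : vfun R d Q -> vfun R d Q -> R)
  (hF : is_rkhs X K F ip)
  (* constraint data *)
  (nI : nat) (ISOC IOm : {set 'I_nI})
  (hIcover : ISOC :|: IOm = [set: 'I_nI]%SET) (hIdisj : ISOC :&: IOm = finset.set0)
  (Kc : 'I_nI -> set 'rV[R]_d)
  (hKc : forall i, compact (Kc i)) (hKcX : forall i, Kc i `<=` X)
  (P : 'I_nI -> nat) (hP : forall i, (0 < P i)%N)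
  (hPOm : forall i, i \in IOm -> P i = 1%N)
  (D : forall i, 'I_(P i) -> 'I_(P i) -> diffop R d Q s)
  (hD : forall i f x, F f -> X x ->
     (opmx X (@D i) f x)^T = opmx X (@D i) f x)
  (f0 : 'I_nI -> vfun R d Q) (hf0 : forall i, F (f0 i))
  (b0 : forall i, 'cV[R]_(P i)) (Gam : forall i, 'M[R]_(P i, B))
  (M : 'I_nI -> nat)
  (* tightening data for i in I_SOC *)
  (xt : forall i, 'I_(M i) -> 'rV[R]_d) (del : forall i, 'I_(M i) -> R)
  (hxt : forall i m, i \in ISOC -> X (xt i m))
  (hdel : forall i m, i \in ISOC -> 0 < del i m)
  (hcovS : forall i, i \in ISOC ->
     Kc i `<=` \bigcup_(m in [set: 'I_(M i)]) ballX X nu (xt i m) (del i m))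
  (* tightening data for i in I_Omega *)
  (JB JH : forall i, 'I_(M i) -> nat)
  (c : forall i m, 'I_(JB i m) -> vfun R d Q)
  (r : forall i m, 'I_(JB i m) -> R)
  (v : forall i m, 'I_(JH i m) -> vfun R d Q)
  (rho : forall i m, 'I_(JH i m) -> R)
  (hc : forall i m j, i \in IOm -> F (c i m j))
  (hr : forall i m j, i \in IOm -> 0 < r i m j)
  (hv : forall i m j, i \in IOm -> F (v i m j) /\ v i m j <> 0)
  (hOm : forall i m, i \in IOm ->
     Omega_set F ip (@c i m) (@r i m) (@v i m) (@rho i m) !=set0)
  (hcovOm : forall i, i \in IOm ->
     [set opK X (D i (Ordinal (hP i)) (Ordinal (hP i))) K x | x in Kc i]
     `<=` \bigcup_(m in [set: 'I_(M i)])
            ip_closure F ip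
              (Omega_set F ip (@c i m) (@r i m) (@v i m) (@rho i m)))
  (* objective *)
  (N : nat) (J : 'I_N -> nat) (x : 'I_N -> 'rV[R]_d) (hx : forall n, X (x n))
  (D0 : forall n, 'I_(J n) -> diffop R d Q s)
  (L : 'cV[R]_B -> 'rV[R]_(\sum_n J n) -> \bar R)
  (hL : forall b y, L b y <> -oo%E)
  (Reg : R -> R)
  (hReg : forall z w : R, 0 <= z -> z <= w -> Reg z <= Reg w) :
  let C_app : set (vfun R d Q * 'cV[R]_B) :=
    (F `*` [set: 'cV[R]_B]) `&`
    (\bigcap_(i in [set i | i \in ISOC])
       C_soc X nu K F ip (@D i) (f0 i) (b0 i) (Gam i) (@xt i) (@del i)) `&`
    (\bigcap_(i in [set i | i \in IOm])
       C_omega F ip (f0 i) (b0 i (Ordinal (hP i)) 0)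
         (row (Ordinal (hP i)) (Gam i)) (@c i) (@r i) (@v i) (@rho i)) in
  let LS : vfun R d Q * 'cV[R]_B -> \bar R := loss_S X D0 x ip L Reg in
  ((exists fb, minimizer C_app LS fb) ->
   exists (fb : vfun R d Q * 'cV[R]_B)
     (aL : forall n, 'I_(J n) -> R)
     (aS : forall i, 'I_(P i) -> 'I_(P i) -> 'I_(M i) -> R)
     (aB : forall i m, 'I_(JB i m) -> R)
     (aH : forall i m, 'I_(JH i m) -> R)
     (a0 : 'I_nI -> R),
     minimizer C_app LS fb /\
     fb.1 =
       \sum_n \sum_j aL n j *: opK X (D0 n j) K (x n)
       + \sum_(i in ISOC) \sum_p1 \sum_p2 \sum_m
           aS i p1 p2 m *: opK X (D i p1 p2) K (xt i m)
       + \sum_(i in IOm) \sum_m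
           (\sum_j aB i m j *: c i m j + \sum_j aH i m j *: v i m j)
       + \sum_i a0 i *: f0 i) /\
  (Reg z @[z --> +oo] --> +oo ->
   (forall rad : R, 0 < rad -> forall A : R, exists t : R,
      forall b : 'cV[R]_B, t <= l2norm b ->
      (A%:E <= ereal_inf [set L b y | y in [set y | (l2norm y <= rad)%R]])%E) ->
   (exists l : R, forall fb, C_app fb ->
      (l%:E <= L fb.2 (sample_values X D0 x fb.1))%E) ->
   lower_semicontinuous
     (fun by_ : 'cV[R]_B * 'rV[R]_(\sum_n J n) => L by_.1 by_.2) ->
   (forall z a : R, 0 <= z -> a < Reg z ->
      \forall w \near z, 0 <= w -> a < Reg w) ->
   weakly_lsc (F `*` [set: 'cV[R]_B]) (ip_prod ip)
     (fun fb => LS fb + char_fun R C_app fb)%E /\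
   coercive (F `*` [set: 'cV[R]_B]) (ip_prod ip)
     (fun fb => LS fb + char_fun R C_app fb)%E).
Proof.
move=> C_app LS; have hH := hilbert_pre (rkhs_hilbert hF).
have hv' i m j : i \in IOm -> F (v i m j) by move=> iO; have [] := hv i m j iO.
split; last first.
  move=> cReg cL bL lscL lscR.
  split; last exact: (loss_S_coercive hX hK hKs hF hx hL hReg cReg cL bL).
  suff hw : forall fb, F fb.1 -> ~ C_app fb ->
      \forall y \near wnbhs (F `*` [set: 'cV[R]_B]) (ip_prod ip (n := B)) fb, ~ C_app y.
    exact: (loss_S_weakly_lsc hX hK hKs hF hx D0 hL hReg hw lscL lscR).
  move=> fb hf nC.
  have FW : Filter (nbhs (wnbhs (F `*` [set: 'cV[R]_B]) (ip_prod ip (n := B)) fb)).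
    exact: wnbhs_filter.
  (* A point outside the intersection violates a single constraint, and that violation persists on a
     weak neighbourhood. *)
  have [[i iS hi]|hS] := pselect (exists2 i, i \in ISOC &
      ~ C_soc X nu K F ip (@D i) (f0 i) (b0 i) (Gam i) (@xt i) (@del i) fb).
    have hn := C_soc_wclosed hX hnu hK hKs hF (hD i) (hP i)
      (fun m => hxt i m iS) (fun m => hdel i m iS) (hf0 i) hf hi.
    by apply: (@filterS _ _ FW _ _ _ hn) => y ny [[_ /(_ i iS)]].
  have [[i iO hi]|hO] := pselect (exists2 i, i \in IOm &
      ~ C_omega F ip (f0 i) (b0 i (Ordinal (hP i)) 0)
         (row (Ordinal (hP i)) (Gam i)) (@c i) (@r i) (@v i) (@rho i) fb).
    have hn := C_omega_wclosed hF (hf0 i) (fun m j => hc i m j iO)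
      (fun m j => hv' i m j iO) (fun m => hOm i m iO) hf hi.
    by apply: (@filterS _ _ FW _ _ _ hn) => y ny [_ /(_ i iO)].
  exfalso; apply: nC; split; first (split; first exact: (conj hf I)).
    by move=> i /= iS; apply: contrapT => hi; apply: hS; exists i.
  by move=> i /= iO; apply: contrapT => hi; apply: hO; exists i.
move=> [[f b] [[[[/= hf _] hS] hO] hmin]].
have [g [aL [aS [aB [aH [a0 [eg [hg ng] hval gS gO]]]]]]] :=
  representer hX hnu hK hKs hF hP D hf0 b0 Gam hxt hdel rho hc hr hv' hx D0 hf.
exists (g, b), aL, aS, aB, aH, a0; split; last exact: eg.
have Cg : C_app (g, b).
  split; first (split; first exact: (conj hg I)).
    by move=> i iS; apply: gS => //; exact: hS.
  by move=> i iO; apply: gO => //; exact: hO.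
(* With the same b and the same samples, only the regularizer changes, and it does not increase. *)
split=> // fb' /hmin; apply: le_trans; rewrite /LS /loss_S /= hval.
by apply: leeD2l; rewrite lee_fin; apply: hReg => //; exact: nrm_ge0.
Qed.
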